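(* There is an absolute constant $K$ such that for every $n\ge3$ and every Clifford circuit $U$ on $n$ qubits, the controlled unitary $c(U)$ can be implemented, without ancillas, by a Clifford+T circuit with $T$-depth at most $K$ and $T$-count at most $Kn$ (i.e. with constant $T$-depth and $O(n)$ $T$-count).
   Context: A Clifford circuit is a circuit of gates $H$, $S=\mathrm{diag}(1,i)$ and CNOT, and we identify it with its unitary. $T=\mathrm{diag}(1,e^{i\pi/4})$. For a unitary $U$ on $n$ qubits, $c(U)$ is the unitary on $n+1$ qubits with $c(U)(|0\rangle\otimes|\psi\rangle)=|0\rangle\otimes|\psi\rangle$ and $c(U)(|1\rangle\otimes|\psi\rangle)=|1\rangle\otimes U|\psi\rangle$. A Clifford+T circuit is a unitary circuit of gates $H$, $S$, CNOT, $T$, $T^\dagger$; here it acts only on the $n+1$ qubits of $c(U)$, with no measurements. Its $T$-count is its number of $T$ and $T^\dagger$ gates. It has $T$-depth at most $D$ if it can be written as $K_DL_DK_{D-1}\cdots K_1L_1K_0$ where each $K_j$ is a Clifford circuit and each $L_j$ is a product of $T$ and $T^\dagger$ gates on distinct qubits. *)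

(* Defs.v *)
From mathcomp Require Import all_boot all_order all_algebra.
From mathcomp.real_closed Require Import mxtens.

Set Implicit Arguments.
Unset Strict Implicit.
Unset Printing Implicit Defensive.

Import Order.TTheory GRing.Theory Num.Theory.
Local Open Scope ring_scope.

(* dimn n = 2 ^ n; the recursive form makes dimn n.+1 convertible to
   2 * dimn n, so that Kronecker products need no casts. *)
Fixpoint dimn (n : nat) : nat := if n is n'.+1 then (2 * dimn n')%N else 1%N.

Section Matrices.
Variable C : numClosedFieldType.

(* e^(i pi / 4) = (1 + i) / sqrt 2 *)
Definition omega : C := (1 + 'i) / sqrtC 2.

(* The projector |a><a|. *)
Definition mxP (a : 'I_2) : 'M[C]_2 := delta_mx a a.
Definition mxX : 'M[C]_2 := \matrix_(a, b) (a != b)%:R.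
Definition mxH : 'M[C]_2 :=
  (sqrtC 2)^-1 *: \matrix_(a, b) (-1) ^+ ((a : nat) * (b : nat))%N.
Definition mxS : 'M[C]_2 := diag_mx (\row_(a < 2) 'i ^+ a).
Definition mxT : 'M[C]_2 := diag_mx (\row_(a < 2) omega ^+ a).
Definition mxTdg : 'M[C]_2 := diag_mx (\row_(a < 2) omega^* ^+ a).

(* 1 (x) ... (x) A (x) ... (x) 1, with A in position j; qubit 0 is the
   leftmost tensor factor. *)
Fixpoint on1 (A : 'M[C]_2) (n : nat) : 'I_n -> 'M[C]_(dimn n) :=
  if n is n'.+1 return 'I_n -> 'M[C]_(dimn n) then
    fun j => if unlift ord0 j is Some j' then 1%:M *t on1 A j'
             else A *t 1%:M
  else fun=> 1%:M.

(* |0><0| on j + |1><1| on j times X on k *)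
Definition mxCNOT (n : nat) (j k : 'I_n) : 'M[C]_(dimn n) :=
  on1 (mxP 0) j + on1 (mxP 1) j *m on1 mxX k.

(* The control is the added qubit 0. *)
Definition controlled (n : nat) (U : 'M[C]_(dimn n)) : 'M[C]_(dimn n.+1) :=
  mxP 0 *t 1%:M + mxP 1 *t U.

Definition ket (a : 'I_2) : 'cV[C]_2 := delta_mx a 0.

Lemma controlled_ket0 n (U : 'M[C]_(dimn n)) (psi : 'cV[C]_(dimn n)) :
  controlled U *m (ket 0 *t psi) = ket 0 *t psi.
Proof.
rewrite /controlled /mxP /ket mulmxDl !tensmx_mul mul1mx mul_delta_mx.
by rewrite mul_delta_mx_0 // tens0mx addr0.
Qed.

Lemma controlled_ket1 n (U : 'M[C]_(dimn n)) (psi : 'cV[C]_(dimn n)) :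
  controlled U *m (ket 1 *t psi) = ket 1 *t (U *m psi).
Proof.
rewrite /controlled /mxP /ket mulmxDl !tensmx_mul mul_delta_mx.
by rewrite mul_delta_mx_0 // tens0mx add0r.
Qed.

End Matrices.

Inductive clifford_gate (n : nat) : Type :=
  | GateH of 'I_n
  | GateS of 'I_n
  | GateCNOT (control target : 'I_n) of control != target.

Inductive gate (n : nat) : Type :=
  | Clifford of clifford_gate n
  | GateT of 'I_n
  | GateTdg of 'I_n.

Arguments Clifford {n}.

(* The head of a circuit is the gate applied first. *)
Definition clifford_circuit (n : nat) : Type := seq (clifford_gate n).
Definition circuit (n : nat) : Type := seq (gate n).

Definition clifford_gate_mx (C : numClosedFieldType) (n : nat)
    (g : clifford_gate n) : 'M[C]_(dimn n) :=
  match g with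
  | GateH j => on1 (mxH C) j
  | GateS j => on1 (mxS C) j
  | GateCNOT j k _ => mxCNOT C j k
  end.

Definition gate_mx (C : numClosedFieldType) (n : nat) (g : gate n)
    : 'M[C]_(dimn n) :=
  match g with
  | Clifford g' => clifford_gate_mx C g'
  | GateT j => on1 (mxT C) j
  | GateTdg j => on1 (mxTdg C) j
  end.

Fixpoint circuit_mx (C : numClosedFieldType) (n : nat) (c : circuit n)
    : 'M[C]_(dimn n) :=
  if c is g :: c' then circuit_mx C c' *m gate_mx C g else 1%:M.

Definition clifford_mx (C : numClosedFieldType) (n : nat)
    (c : clifford_circuit n) : 'M[C]_(dimn n) :=
  circuit_mx C (map Clifford c).

Definition T_qubit (n : nat) (g : gate n) : option 'I_n :=
  match g with
  | Clifford _ => None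
  | GateT j => Some j
  | GateTdg j => Some j
  end.

Definition is_T (n : nat) (g : gate n) : bool := isSome (T_qubit g).

Definition T_count (n : nat) (c : circuit n) : nat := count (@is_T n) c.

Definition T_layer (n : nat) (L : circuit n) : bool :=
  all (@is_T n) L && uniq (pmap (@T_qubit n) L).

(* c = K_0 L_1 K_1 ... L_D K_D in time order; a layer L_j may be empty. *)
Fixpoint T_depth_le (n : nat) (D : nat) (c : circuit n) : Prop :=
  if D is D'.+1 then
    exists (c' L : circuit n) (K : clifford_circuit n),
      [/\ T_depth_le D' c', T_layer L & c = c' ++ L ++ map Clifford K]
  else exists K : clifford_circuit n, c = map Clifford K.

(* Main.v *)
(** Conjugating [U] by a Clifford [g] conjugates [controlled U] by [1 (x) g],
    which is free, so it suffices to write [U], up to a power of [omega] and a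
    Pauli operator, as a product of a bounded number of Clifford conjugates of
    parallel products of [S] gates.  The controlled version of a parallel [S]
    layer costs two [T] layers, by [S = omega T X T^dagger X] on each target,
    and a power of [T] on the control.

    The factorisation happens in the symplectic group over F_2.  Every
    symmetric [B] is [L L^T + D] with [L] a product of transvections and [D]
    diagonal, so each unipotent [[1 B; 0 1]] is a product of two conjugates of
    [S] layers.  A symplectic matrix becomes lower * diag(A, A^-T) * upper once
    it is multiplied by one unipotent making its upper left block invertible.
    For [A] symmetric, diag(A, A^-T) is a bounded product of unipotents; and
    every invertible [A] over F_2 is upper * lower * upper unitriangular, while
    a unitriangular matrix times two permutation matrices is Hessenberg, hence
    a product of two symmetric matrices (both Hankel in a cyclic basis).

    A Clifford circuit acting trivially on the Pauli group modulo phases is a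
    scalar times a Pauli operator.  The scalar is a power of [omega]: it lies
    in Q(omega), and taking determinants shows that it is a root of unity of
    2-power order. *)

Require Import Defs.
From mathcomp Require Import all_boot all_order all_algebra.
From mathcomp.real_closed Require Import mxtens.
From mathcomp Require Import ring zify.

Set Implicit Arguments.
Unset Strict Implicit.
Unset Printing Implicit Defensive.

Import Order.TTheory GRing.Theory Num.Theory.
Local Open Scope ring_scope.

(** * Linear algebra over F_2 *)

Lemma F2_cases (x : 'F_2) : x = 0 \/ x = 1.
Proof. by case: x => [[|[|k]] Hk] //; [left | right]; apply: val_inj. Qed.

Lemma mxF2_addxx m n (A : 'M['F_2]_(m, n)) : A + A = 0.
Proof. by apply/matrixP=> i j; rewrite !mxE addrr_pchar2 // pchar_Fp. Qed.

Lemma mxF2_opp m n (A : 'M['F_2]_(m, n)) : - A = A.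
Proof. by apply/eqP; rewrite eq_sym -addr_eq0 mxF2_addxx. Qed.

Lemma mxF2_addK m n (A B : 'M['F_2]_(m, n)) : A + (A + B) = B.
Proof. by rewrite addrA mxF2_addxx add0r. Qed.

Lemma F2_neq0 (x : 'F_2) : x != 0 -> x = 1.
Proof. by case: (F2_cases x) => ->. Qed.

(** These are the matrices by which CNOT circuits act on the X part of a Pauli vector, one
    transvection per gate. *)
Inductive cnot_product n : 'M['F_2]_n -> Prop :=
  | cnot_product1 : cnot_product 1%:M
  | cnot_productM j k A : j != k -> cnot_product A -> cnot_product ((1%:M + delta_mx j k) *m A).

Lemma cnot_product_mul n (A B : 'M_n) : cnot_product A -> cnot_product B -> cnot_product (A *m B).
Proof.
elim=> [|j k A' Hjk _ IH] HB; first by rewrite mul1mx.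
by rewrite -mulmxA; apply: cnot_productM => //; apply: IH.
Qed.

Lemma cnot_product_delta n (j k : 'I_n) : j != k -> cnot_product (1%:M + delta_mx j k).
Proof.
move=> H; rewrite -[X in cnot_product X]mulmx1; apply: cnot_productM => //.
exact: cnot_product1.
Qed.

Lemma cnot_product_lift n (A : 'M_n) : cnot_product A -> cnot_product (block_mx (1%:M : 'M_1) 0 0 A).
Proof.
elim=> [|j k A' Hjk _ IH]; first by rewrite -scalar_mx_block; exact: cnot_product1.
have -> : block_mx (1%:M : 'M['F_2]_1) 0 0 ((1%:M + delta_mx j k) *m A') =
  (1%:M + delta_mx (rshift 1 j) (rshift 1 k)) *m block_mx (1%:M : 'M_1) 0 0 A'.
  rewrite (_ : delta_mx _ _ = block_mx (0 : 'M_1) 0 0 (delta_mx j k)).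
    rewrite -[1%:M + block_mx _ _ _ _]/((1%:M : 'M_(1 + n)) + _) (@scalar_mx_block _ 1 n 1).
    rewrite add_block_mx !addr0 mulmx_block.
    by rewrite !(mul0mx, mulmx0, mul1mx, addr0, add0r).
  by apply/matrixP=> a b; rewrite !mxE; case: splitP => i Hi; rewrite mxE;
    case: splitP => l Hl; rewrite !mxE -!val_eqE /= Hi Hl //= ?(ord1 i) ?(ord1 l) //= andbF.
by apply: cnot_productM IH; rewrite eq_rshift.
Qed.

(** Multiplying two such matrices adds their columns [c], so each nonzero entry of [c] contributes
    one transvection. *)
Lemma cnot_product_col n (c : 'cV_n) : cnot_product (block_mx (1%:M : 'M_1) 0 c 1%:M).
Proof.
rewrite (matrix_sum_delta c).
pose P (c : 'cV['F_2]_n) := cnot_product (block_mx (1%:M : 'M_1) 0 c 1%:M).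
have P0 : P 0 by rewrite /P -scalar_mx_block; exact: cnot_product1.
have PD c1 c2 : P c1 -> P c2 -> P (c1 + c2).
  move=> H1 H2; have := cnot_product_mul H1 H2.
  by rewrite mulmx_block !(mul0mx, mulmx0, mul1mx, mulmx1, addr0, add0r).
apply: (big_ind P) => // i _; apply: (big_ind P) => // j _.
case: (F2_cases (c i j)) => ->; rewrite ?scale0r // scale1r ord1.
rewrite /P (_ : block_mx _ _ _ _ = 1%:M + delta_mx (rshift 1 i) (lshift n 0)).
  by apply: cnot_product_delta; rewrite eq_rlshift.
rewrite (@scalar_mx_block _ 1 n 1) (_ : delta_mx _ _ = block_mx (0 : 'M_1) 0 (delta_mx i 0) 0).
  by rewrite add_block_mx !(addr0, add0r).
by apply/matrixP=> a b; rewrite !mxE; case: splitP => k Hk; rewrite mxE;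
    case: splitP => l Hl; rewrite !mxE -!val_eqE /= Hk Hl //= ?(ord1 k) ?(ord1 l) //= ?andbF ?andbT.
Qed.

(* Choosing [D] so that every pivot is [1] makes the symmetric elimination succeed. *)
Lemma sym_factor n (B : 'M['F_2]_n) : B^T = B ->
  exists L D, cnot_product L /\ B = L *m L^T + diag_mx D.
Proof.
elim: n B => [|n IH] B symB.
  by exists 1%:M, 0; split; [exact: cnot_product1 | apply/matrixP=> -[]].
move: B symB; rewrite -[n.+1]/(1 + n)%N => B symB.
rewrite -(submxK B) in symB *.
set b := ulsubmx B in symB *; set r := ursubmx B in symB *.
set c := dlsubmx B in symB *; set B' := drsubmx B in symB *.
move: symB; rewrite tr_block_mx => /eq_block_mx[_ cr rc symB].
(* The entry [1 + b] of the diagonal part turns the pivot [b] into [1], and [B' + c c^T] is the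
   Schur complement of that pivot. *)
have [|L [D [eL EL]]] := IH (B' + c *m c^T).
  by rewrite linearD /= trmx_mul trmxK symB.
exists (block_mx 1%:M 0 c L), (row_mx (1%:M + b) D); split.
  have := cnot_product_mul (cnot_product_col c) (cnot_product_lift eL).
  by rewrite mulmx_block !(mul0mx, mulmx0, mul1mx, mulmx1, addr0, add0r).
rewrite tr_block_mx mulmx_block !(trmx1, trmx0, mul0mx, mulmx0, mul1mx, mulmx1, addr0, add0r).
rewrite diag_mx_row add_block_mx.
rewrite (_ : diag_mx (1%:M + b) = 1%:M + b); last first.
  by apply/matrixP=> i j; rewrite !ord1 !mxE eqxx mulr1n.
by rewrite mxF2_addK cr !addr0 -[c *m r + _ + _]addrA -EL -cr addrC -addrA mxF2_addxx addr0.
Qed.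

(** * Triangular factorisation of invertible matrices *)

Definition unit_lower n (L : 'M['F_2]_n) :=
  forall i j : 'I_n, (i <= j)%N -> L i j = (i == j)%:R.

Lemma unit_lower_unitmx n (L : 'M_n) : unit_lower L -> L \in unitmx.
Proof.
move=> HL; rewrite unitmxE det_trig.
  by rewrite big1 ?unitr1 // => i _; rewrite HL // eqxx.
apply/is_trig_mxP => i j Hij; rewrite HL; last exact: ltnW.
by have /negbTE -> : i != j by rewrite neq_ltn Hij.
Qed.

Lemma unit_lower_block n (c : 'cV_n) (L : 'M_n) :
  unit_lower L -> unit_lower (block_mx (1%:M : 'M_1) 0 c L).
Proof.
move=> HL i j; rewrite !mxE -(inj_eq val_inj) /=; case: splitP => k Hk; rewrite mxE;
    case: splitP => l Hl; rewrite ?mxE Hk Hl ?ord1 //= => Hij.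
by rewrite HL ?eqSS.
Qed.

Lemma upper_block n (r : 'rV_n) (U : 'M_n) :
  unit_lower U^T -> unit_lower (block_mx (1%:M : 'M_1) r 0 U)^T.
Proof.
move=> HU; rewrite tr_block_mx trmx1 trmx0; exact: unit_lower_block.
Qed.

(** Over F_2 elimination fails only at a zero pivot. Invertibility then gives a lower row with a [1]
    in the first column, and adding it to the first row, an upper unitriangular operation, makes the
    pivot [1]. Induction applies to the Schur complement [S]. *)
Lemma ulu_factor n (A : 'M['F_2]_n) : A \in unitmx ->
  exists V L W, [/\ unit_lower V^T, unit_lower L, unit_lower W^T & A = V *m L *m W].
Proof.
elim: n A => [|n IH] A.
  exists 1%:M, 1%:M, 1%:M; split; try by case.
  by apply/matrixP=> -[].
move: A; rewrite -[n.+1]/(1 + n)%N => M; rewrite -(submxK M).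
set a := ulsubmx M; set b := ursubmx M; set c := dlsubmx M; set A := drsubmx M => unitM.
have [e He] : exists e : 'rV_n, a + e *m c = 1%:M.
  case: (F2_cases (a 0 0)) => Ha; last first.
    by exists 0; rewrite mul0mx addr0; apply/matrixP => i j; rewrite !ord1 Ha mxE.
  have a0 : a = 0 by apply/matrixP=> i j; rewrite !ord1 Ha mxE.
  have [i Hi] : exists i, c i 0 != 0.
    case: (pickP (fun i => c i 0 != 0)) => [i Hi|c0]; first by exists i.
    have c00 : c = 0 by apply/matrixP=> i j; rewrite ord1 [RHS]mxE; apply/eqP/negbFE/(c0 i).
    by move: unitM; rewrite a0 c00 unitmxE det_ublock det0 mul0r unitr0.
  exists (delta_mx 0 i); rewrite a0 add0r; apply/matrixP=> k l; rewrite !ord1.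
  by rewrite -rowE [LHS]mxE (F2_neq0 Hi) mxE.
pose r := b + e *m A; pose S := A + c *m r.
(* Moving diag(1, v) to the left past the column [c] replaces [c] by [v^-1 c]. This is used with
   trivial [v] and [u] to see that [S] is invertible, and then with the factors of [S] given by
   induction. *)
have defM X (v l' u : 'M_n) : v \in unitmx -> X = v *m l' *m u ->
    X = S -> block_mx a b c A = block_mx 1%:M (e *m v) 0 v *m
     block_mx 1%:M 0 (invmx v *m c) l' *m block_mx 1%:M r 0 u.
  move=> Uv EX XS; rewrite -mulmxA !mulmx_block.
  have E1 : v *m (invmx v *m c) = c by rewrite mulKVmx.
  have E2 : v *m (invmx v *m c *m r + l' *m u) = A.
    by rewrite mulmxDr -mulmxA mulKVmx // [v *m _]mulmxA -EX XS addrC -addrA mxF2_addxx addr0.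
  rewrite !(mul0mx, mulmx0, mul1mx, mulmx1, addr0, add0r) -2!(mulmxA e) E1 E2 -He.
  by rewrite -2!addrA !mxF2_addxx !addr0.
have US : S \in unitmx.
  have := defM S 1%:M S 1%:M (unitmx1 _ _); rewrite mul1mx mulmx1 => /(_ erefl erefl) E.
  move: unitM; rewrite E !unitmx_mul => /andP[/andP[_ U2] _].
  by move: U2; rewrite unitmxE det_lblock det1 mul1r -unitmxE.
have [v [l' [u [Hv Hl Hu ES]]]] := IH S US.
have Uv : v \in unitmx by rewrite -unitmx_tr unit_lower_unitmx.
exists (block_mx 1%:M (e *m v) 0 v), (block_mx 1%:M 0 (invmx v *m c) l'), (block_mx 1%:M r 0 u).
split; [exact: upper_block | exact: unit_lower_block | exact: upper_block | exact: defM ES erefl].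
Qed.

(** * Products of symmetric matrices *)

Section Involution.
Variables (n : nat) (f : 'I_n -> 'I_n).
Hypothesis fK : involutive f.

Definition involution_mx : 'M['F_2]_n := \matrix_(i, j) (i == f j)%:R.

Lemma mulmx_involution m (X : 'M_(m, n)) i j : (X *m involution_mx) i j = X i (f j).
Proof.
rewrite mxE (bigD1 (f j)) //= mxE eqxx mulr1 big1 ?addr0 // => k /negbTE kf.
by rewrite mxE kf mulr0.
Qed.

Lemma tr_involution : involution_mx^T = involution_mx.
Proof. by apply/matrixP=> i j; rewrite !mxE eq_sym (can2_eq fK fK). Qed.

Lemma involution_mxK : involution_mx *m involution_mx = 1%:M.
Proof. by apply/matrixP=> i j; rewrite mulmx_involution !mxE fK. Qed.

Lemma involution_unit : involution_mx \in unitmx.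
Proof. by case: (mulmx1_unit involution_mxK). Qed.
End Involution.

Definition sym_unit n (S : 'M['F_2]_n) := S^T = S /\ S \in unitmx.

Lemma sym_unit_involution n (f : 'I_n -> 'I_n) :
  involutive f -> sym_unit (involution_mx f).
Proof. by move=> fK; split; [exact: tr_involution | exact: involution_unit]. Qed.

(** From [A = K^-1 H' G^-1] and [G^-1 = H^-1 K], inserting [K^-T K^T] in the middle leaves two
    factors, each congruent to a symmetric matrix. *)
Lemma sym_unit_factor n (K A G H H' : 'M['F_2]_n) :
  K \in unitmx -> sym_unit H -> sym_unit H' ->
  K *m G = H -> K *m A *m G = H' ->
  exists S1 S2, [/\ sym_unit S1, sym_unit S2 & A = S1 *m S2].
Proof.
move=> unitK [symH unitH] [symH' unitH'] KG KAG.
have unitG : G \in unitmx by move: unitH; rewrite -KG unitmx_mul => /andP[].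
exists (invmx K *m H' *m (invmx K)^T), (K^T *m invmx H *m K); split.
- split; first by rewrite !trmx_mul trmxK symH' mulmxA.
  by rewrite !unitmx_mul unitmx_tr unitmx_inv unitK unitH'.
- split; first by rewrite !trmx_mul trmxK trmx_inv symH mulmxA.
  by rewrite !unitmx_mul unitmx_tr unitmx_inv unitK unitH.
apply: (can_inj (mulKmx unitK)); apply: (can_inj (mulmxK unitG)).
rewrite KAG trmx_inv !mulmxA mulmxV // mul1mx mulmxKV ?unitmx_tr //.
by rewrite -[_ *m K *m G]mulmxA KG mulmxKV.
Qed.

Lemma hessenberg_sym m (A : 'M['F_2]_m.+1) : A \in unitmx ->
  (forall i j : 'I_m.+1, (i < j)%N -> A i j = (j == i.+1 :> nat)%:R) ->
  exists S1 S2, [/\ sym_unit S1, sym_unit S2 & A = S1 *m S2].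
Proof.
move=> unitA hessA.
(* The rows [e_0 A^k] form a unitriangular, hence cyclic, basis [K].  With [lam] the
   functional that reads off the last coordinate in it, [H] and [H'] are Hankel. *)
pose K : 'M_m.+1 := \matrix_(k, j) (A ^+ k) 0 j.
have lowA k (j : 'I_m.+1) : (k <= j)%N -> (A ^+ k) 0 j = (k == j :> nat)%:R.
  elim: k j => [|k IH] j Hkj.
    by rewrite expr0 mxE.
  rewrite exprSr -mulmxE mxE.
  have Hk : (k < m.+1)%N by apply: leq_ltn_trans (ltn_ord j); exact: ltnW.
  rewrite (bigD1 (Ordinal Hk)) //= IH //= eqxx mul1r hessA // eq_sym.
  rewrite big1 ?addr0 // => i ik.
  case: (ltngtP k i) => [ki|ki|ki].
  - by rewrite (IH _ (ltnW ki)) ltn_eqF // mul0r.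
  - rewrite hessA; last exact: ltn_trans ki Hkj.
    by rewrite gtn_eqF ?mulr0 //; apply: leq_ltn_trans Hkj.
  - by move: ik; rewrite -val_eqE /= ki eqxx.
have unitK : K \in unitmx.
  apply: unit_lower_unitmx => i j Hij; rewrite mxE lowA //.
pose lam := invmx K *m delta_mx ord_max (0 : 'I_1).
pose h k := (A ^+ k *m lam) 0 0.
have hE k : (k <= m)%N -> h k = (k == m)%:R.
  move=> Hk; have := mulKVmx unitK (delta_mx ord_max (0 : 'I_1)).
  move/matrixP/(_ (inord k) 0); rewrite -/lam !mxE andbT -val_eqE /= inordK // => <-.
  by rewrite /h mxE; apply: eq_bigr => j _; rewrite [K _ _]mxE inordK.
pose H : 'M_m.+1 := \matrix_(i, j) h (i + j)%N.
pose H' : 'M_m.+1 := \matrix_(i, j) h (i + j).+1.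
pose G : 'M_m.+1 := \matrix_(l, j) (A ^+ j *m lam) l 0.
have KG : K *m G = H.
  apply/matrixP=> i j; rewrite !mxE /h exprD -mulmxE -mulmxA mxE.
  by apply: eq_bigr => l _; rewrite !mxE.
have KAG : K *m A *m G = H'.
  apply/matrixP=> i j; rewrite !mxE /h -addSn exprD -mulmxE -mulmxA mxE.
  apply: eq_bigr => l _; rewrite exprSr -mulmxE !mxE; congr (_ * _).
  by apply: eq_bigr => k _; rewrite !mxE.
have unitH : H \in unitmx.
  (* [h] vanishes before [m] and is [1] at [m], so reversing the columns of the Hankel matrix [H]
     makes it lower unitriangular. *)
  have : unit_lower (H *m involution_mx (@rev_ord m.+1)).
    move=> i j Hij; rewrite mulmx_involution mxE /= hE; last first.
      by rewrite subSS; have := ltn_ord j; lia.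
    congr (_ %:R); rewrite -val_eqE /= subSS; have := ltn_ord j; lia.
  by move=> lowH; have := unit_lower_unitmx lowH; rewrite unitmx_mul => /andP[uH _]; exact: uH.
have symH : H^T = H by apply/matrixP=> i j; rewrite !mxE addnC.
have symH' : H'^T = H' by apply/matrixP=> i j; rewrite !mxE addnC.
have unitH' : H' \in unitmx.
  rewrite -KAG !unitmx_mul unitK unitA /=.
  by move: unitH; rewrite -KG unitmx_mul => /andP[].
exact: sym_unit_factor unitK (conj symH unitH) (conj symH' unitH') KG KAG.
Qed.

(* [L R1 R2] is [L] with its columns shifted cyclically by one, hence Hessenberg. *)
Lemma unit_lower_sym m (L : 'M['F_2]_m.+1) : unit_lower L ->
  exists S1 S2 S3 S4, [/\ sym_unit S1, sym_unit S2, sym_unit S3, sym_unit S4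
     & L = S1 *m S2 *m S3 *m S4].
Proof.
move=> lowL.
(* The reflections [j -> m - j] and [j -> - j] modulo [m + 1] compose to the rotation [j -> j - 1],
   which is the required cyclic shift. *)
pose f1 := @rev_ord m.+1.
pose f2 (j : 'I_m.+1) : 'I_m.+1 := inord ((m.+1 - j) %% m.+1).
have f2E j : f2 j = (if j == 0 :> nat then 0 else m.+1 - j)%N :> nat.
  rewrite /f2 inordK ?ltn_mod //; case: eqP => [->|j0]; first by rewrite subn0 modnn.
  by rewrite modn_small //; lia.
have f1K : involutive f1 by exact: rev_ordK.
have f2K : involutive f2.
  move=> j; apply: val_inj; rewrite /= !f2E.
  by case: j => [[|j]] //= Hj; case: eqP; lia.
pose R1 := involution_mx f1; pose R2 := involution_mx f2.
have s1 := sym_unit_involution f1K; have s2 := sym_unit_involution f2K.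
have [|i j Hij|S1 [S2 [sS1 sS2 E]]] := @hessenberg_sym m (L *m R1 *m R2).
- by rewrite !unitmx_mul unit_lower_unitmx //= !involution_unit.
- rewrite !mulmx_involution lowL.
    congr (_ %:R). rewrite -val_eqE /= f2E (gtn_eqF (leq_ltn_trans _ Hij)) //.
    by have := ltn_ord j; lia.
  rewrite /= f2E (gtn_eqF (leq_ltn_trans _ Hij)) //.
  by have := ltn_ord j; lia.
exists S1, S2, R2, R1; split; [exact: sS1 | exact: sS2 | exact: s2 | exact: s1 |].
by rewrite -E -[_ *m R2 *m R2]mulmxA involution_mxK // mulmx1 -mulmxA involution_mxK // mulmx1.
Qed.

(** * Symplectic matrices over F_2 *)

Lemma exists_sym_transversal n (A C P Q : 'M['F_2]_n) :
  (A^T *m C)^T = A^T *m C -> P *m A + Q *m C = 1%:M ->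
  exists E, E^T = E /\ A + E *m C \in unitmx.
Proof.
(* After a change of bases [C] is a diagonal projection [p]; then [E = p + p A] works,
   since [A + E p] still generates both [p] and [A]. *)
have [Lc [p [Rc [uL uR EC [pp pT]]]]] : exists Lc p Rc : 'M_n,
  [/\ Lc \in unitmx, Rc \in unitmx, Lc *m p *m Rc = C & p *m p = p /\ p^T = p].
  exists (col_ebase C), (pid_mx (\rank C)), (row_ebase C).
  rewrite col_ebase_unit row_ebase_unit mulmx_ebase tr_pid_mx pid_mx_id //.
  exact: rank_leq_row.
have uLt : Lc^T \in unitmx by rewrite unitmx_tr.
have uRt : Rc^T \in unitmx by rewrite unitmx_tr.
(* [A] is transported by the inverse transpose of [Lc], so that [A^T C] becomes congruent to
   [A0^T p]. The first hypothesis then says that [p A0] is symmetric, and hence so is [p + p A0]. *)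
have [A0 EA] : exists A0, A = invmx Lc^T *m A0 *m Rc.
  by exists (Lc^T *m A *m invmx Rc); rewrite !mulmxA mulVmx // mul1mx mulmxKV.
rewrite -{}EC {}EA => symA invA.
have EA0 : p *m A0 = A0^T *m p.
  have E : (invmx Lc^T *m A0 *m Rc)^T *m (Lc *m p *m Rc) = Rc^T *m (A0^T *m p) *m Rc.
    by rewrite !trmx_mul trmx_inv trmxK !mulmxA mulmxKV.
  rewrite E !trmx_mul !trmxK pT mulmxA in symA.
  exact: can_inj (mulKmx uRt) _ _ (can_inj (mulmxK uR) symA).
have pA0p : p *m A0 *m p = p *m A0 by rewrite EA0 -mulmxA pp.
pose X := A0 + (p + p *m A0) *m p.
have XE : X = A0 + p + p *m A0 by rewrite /X mulmxDl pp pA0p addrA.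
have pX : p *m X = p.
  by rewrite XE !mulmxDr pp mulmxA pp addrAC mxF2_addxx add0r.
have A0X : A0 = (1%:M + p + p *m A0) *m X.
  rewrite !mulmxDl mul1mx pX -pA0p -[p *m A0 *m p *m X]mulmxA pX pA0p XE.
  rewrite -!addrA [p *m A0 + _]addrC -!addrA mxF2_addxx addr0.
  by rewrite mxF2_addxx addr0.
have unitX : X \in unitmx.
  have [P0 [Q0 E1]] : exists P0 Q0 : 'M_n, P0 *m A0 + Q0 *m p = 1%:M.
    exists (Rc *m P *m invmx Lc^T), (Rc *m Q *m Lc).
    have := congr1 (fun X => Rc *m X *m invmx Rc) invA.
    rewrite mulmx1 mulmxV // => <-; rewrite mulmxDr mulmxDl.
    by rewrite !mulmxA !(mulmxK uR).
  have E2 : (P0 *m (1%:M + p + p *m A0) + Q0 *m p) *m X = 1%:M.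
    by rewrite mulmxDl -!mulmxA pX -A0X.
  by case: (mulmx1_unit E2).
exists (invmx Lc^T *m (p + p *m A0) *m invmx Lc); split.
  by rewrite !trmx_mul !trmx_inv trmxK linearD /= trmx_mul pT -EA0 mulmxA.
have E q : invmx Lc^T *m q *m invmx Lc *m (Lc *m p *m Rc) = invmx Lc^T *m (q *m p) *m Rc.
  by rewrite !mulmxA mulmxKV.
by rewrite E -mulmxDl -mulmxDr -/X !unitmx_mul unitmx_inv uLt unitX uR.
Qed.

Section Symplectic.
Variable n : nat.
Implicit Types (E X A L S : 'M['F_2]_n) (M : 'M['F_2]_(n + n)).

(** On row vectors [(x | z)], [umx] of a diagonal matrix is a layer of S gates, [dmx] of a product
    of transvections is a CNOT circuit, and [wmx] is a Hadamard on every qubit. Modulo 2, [wmx] is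
    also the Gram matrix of the symplectic form. *)
Definition umx E : 'M_(n + n) := block_mx 1%:M E 0 1%:M.
Definition lmx E : 'M_(n + n) := block_mx 1%:M 0 E 1%:M.
Definition dmx A : 'M_(n + n) := block_mx A 0 0 (invmx A)^T.
Definition wmx : 'M['F_2]_(n + n) := block_mx 0 1%:M 1%:M 0.

Definition block_simp := (mulmx_block, mul0mx, mulmx0, mul1mx, mulmx1, addr0, add0r).

Lemma umx_add E1 E2 : umx (E1 + E2) = umx E1 *m umx E2.
Proof. by rewrite /umx !block_simp addrC. Qed.

Lemma umx0 : umx 0 = 1%:M.
Proof. by rewrite /umx -scalar_mx_block. Qed.

Lemma dmx1 : dmx 1%:M = 1%:M.
Proof. by rewrite /dmx invmx1 trmx1 -scalar_mx_block. Qed.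

Lemma dmx_mul A1 A2 : A1 \in unitmx -> A2 \in unitmx ->
  dmx (A1 *m A2) = dmx A1 *m dmx A2.
Proof.
move=> u1 u2; rewrite /dmx !block_simp; congr block_mx; rewrite -trmx_mul.
have u12 : A1 *m A2 \in unitmx by rewrite unitmx_mul u1.
congr trmx; apply: (can_inj (mulKmx u12)).
by rewrite mulmxV // mulmxA mulmxK // mulmxV.
Qed.

Lemma dmx_conj L E : L \in unitmx ->
  dmx L *m umx E *m dmx (invmx L) = umx (L *m E *m L^T).
Proof.
move=> uL; rewrite /dmx /umx !block_simp invmxK mulmxV //.
by rewrite -trmx_mul mulmxV // trmx1.
Qed.

(** The first three factors multiply to the antidiagonal matrix with blocks [S] and [S^-1]; [wmx]
    swaps the columns, and symmetry gives [S^-1 = S^-T]. *)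
Lemma dmx_sym S : sym_unit S ->
  dmx S = umx S *m lmx (invmx S) *m umx S *m wmx.
Proof.
case=> symS uS; rewrite /dmx /umx /lmx /wmx !block_simp trmx_inv symS.
by rewrite mulmxV // mulVmx // !mxF2_addxx mul0mx add0r.
Qed.

Lemma wmxE : wmx = umx 1%:M *m lmx 1%:M *m umx 1%:M.
Proof. by rewrite /umx /lmx /wmx !block_simp mxF2_addxx add0r. Qed.

Lemma lmxE E : lmx E = wmx *m umx E *m wmx.
Proof. by rewrite /umx /lmx /wmx !block_simp. Qed.

Definition symplectic M := M *m wmx *m M^T = wmx.

Lemma symplectic1 : symplectic 1%:M.
Proof. by rewrite /symplectic trmx1 mul1mx mulmx1. Qed.

Lemma symplectic_mul M N : symplectic M -> symplectic N -> symplectic (M *m N).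
Proof.
by rewrite /symplectic trmx_mul => HM HN; rewrite mulmxA -[M *m N *m _]mulmxA
  -[M *m _ *m N^T]mulmxA HN.
Qed.

Lemma wmxK : wmx *m wmx = 1%:M.
Proof. by rewrite /wmx !block_simp -scalar_mx_block. Qed.

Lemma symplectic_tr M : symplectic M -> M^T *m wmx *m M = wmx.
Proof.
move=> HM; have H : M *m (wmx *m M^T *m wmx) = 1%:M.
  by rewrite !mulmxA HM wmxK.
have := mulmx1C H => /(congr1 (mulmx wmx)).
by rewrite mulmx1 !mulmxA wmxK mul1mx.
Qed.

Lemma symplectic_umx E : E^T = E -> symplectic (umx E).
Proof.
move=> symE; rewrite /symplectic /umx /wmx tr_block_mx !trmx1 trmx0 !block_simp symE.
by rewrite mxF2_addxx.
Qed.

Lemma mxF2_add_eq0 m k (P Q : 'M['F_2]_(m, k)) : P + Q = 0 -> P = Q.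
Proof. by move/eqP; rewrite addr_eq0 mxF2_opp => /eqP. Qed.

(** Block elimination with [X = C A^-1] and [Y = A^-1 B]. Their symmetry comes from the vanishing
    diagonal blocks of [M^T w M] and [M w M^T], and an off-diagonal block identifies the Schur
    complement with [A^-T]. *)
Lemma symplectic_ldu M : symplectic M -> ulsubmx M \in unitmx ->
  exists X Y, [/\ X^T = X, Y^T = Y & M = lmx X *m dmx (ulsubmx M) *m umx Y].
Proof.
move=> HM; have HM' := symplectic_tr HM; move: HM HM'.
rewrite -{1 2 3 5}(submxK M).
move: (ulsubmx M) (ursubmx M) (dlsubmx M) (drsubmx M) => A B C D.
rewrite /symplectic tr_block_mx /wmx !block_simp.
move=> /eq_block_mx[/mxF2_add_eq0 AB _ _ _] /eq_block_mx[/mxF2_add_eq0 AC _ DABC _] uA.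
have uAt : A^T \in unitmx by rewrite unitmx_tr.
have symX : (C *m invmx A)^T = C *m invmx A.
  rewrite trmx_mul trmx_inv; apply: (can_inj (mulKmx uAt)); rewrite mulKVmx //.
  by apply: (can_inj (mulmxK uA)); rewrite mulmxA mulmxKV.
have symY : (invmx A *m B)^T = invmx A *m B.
  rewrite trmx_mul trmx_inv; apply: (can_inj (mulKmx uA)); rewrite mulKVmx //.
  by apply: (can_inj (mulmxK uAt)); rewrite mulmxA mulmxKV.
exists (C *m invmx A), (invmx A *m B); split=> //.
rewrite /lmx /dmx /umx !block_simp mulmxKV // mulKVmx //; congr block_mx.
apply: trmx_inj; apply: (can_inj (mulmxK uA)).
rewrite linearD /= trmxK mulmxDl mulVmx // !trmx_mul -[_ *m C^T *m A]mulmxA AC.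
rewrite trmx_inv !mulmxA mulmxKV //.
by rewrite -DABC addrC -addrA mxF2_addxx addr0.
Qed.

(** The left block column of a symplectic matrix is isotropic and of full rank, which is what
    [exists_sym_transversal] asks for. The resulting [umx E] is its own inverse, so it moves to the
    front of the factorisation. *)
Lemma symplectic_decomp M : symplectic M ->
  exists E X A Y, [/\ E^T = E, X^T = X, Y^T = Y, A \in unitmx &
    M = umx E *m lmx X *m dmx A *m umx Y].
Proof.
move=> HM.
have [E [symE uA]] : exists E, E^T = E /\ ulsubmx M + E *m dlsubmx M \in unitmx.
  have := symplectic_tr HM; rewrite -{1 2}(submxK M).
  rewrite tr_block_mx /wmx !block_simp => /eq_block_mx[/mxF2_add_eq0 AC _ DABC _].
  by apply: (exists_sym_transversal _ DABC); rewrite -AC trmx_mul trmxK.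
have HEM := symplectic_mul (symplectic_umx symE) HM.
have ulE : ulsubmx (umx E *m M) = ulsubmx M + E *m dlsubmx M.
  by rewrite -{1}(submxK M) /umx !block_simp block_mxKul.
have [|X [Y [symX symY EM]]] := symplectic_ldu HEM; first by rewrite ulE.
exists E, X, (ulsubmx (umx E *m M)), Y; split; [exact: symE | exact: symX | exact: symY | by rewrite ulE |].
by rewrite -!mulmxA [lmx X *m _]mulmxA -EM mulmxA -umx_add mxF2_addxx umx0 mul1mx.
Qed.
End Symplectic.

(** * Tensor products and the action on Pauli operators *)

Section Tensor.
Variable C : numClosedFieldType.

Lemma tensmxDl m n p q (A B : 'M[C]_(m, n)) (D : 'M[C]_(p, q)) :
  (A + B) *t D = A *t D + B *t D.
Proof. by apply/matrixP=> i j; rewrite !mxE mulrDl. Qed.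

Lemma tensmxDr m n p q (A : 'M[C]_(m, n)) (B D : 'M[C]_(p, q)) :
  A *t (B + D) = A *t B + A *t D.
Proof. by apply/matrixP=> i j; rewrite !mxE mulrDr. Qed.

Lemma tensmxZl m n p q c (A : 'M[C]_(m, n)) (D : 'M[C]_(p, q)) :
  (c *: A) *t D = c *: (A *t D).
Proof. by apply/matrixP=> i j; rewrite !mxE mulrA. Qed.

Lemma tensmxZr m n p q c (A : 'M[C]_(m, n)) (D : 'M[C]_(p, q)) :
  A *t (c *: D) = c *: (A *t D).
Proof. by apply/matrixP=> i j; rewrite !mxE mulrCA. Qed.

Lemma tensmx11 m n : (1%:M : 'M[C]_m) *t (1%:M : 'M_n) = 1%:M.
Proof.
apply/matrixP=> i j; case: (mxtens_indexP i) => i1 i2; case: (mxtens_indexP j) => j1 j2.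
rewrite tensmxE !mxE (inj_eq (can_inj (@mxtens_indexK m n))) xpair_eqE.
by case: (i1 == j1); rewrite ?mul1r ?mul0r.
Qed.

(** Every one-qubit gate is such a product, and [tens_mul] multiplies these factor by factor, which
    reduces gate identities to identities of 2 x 2 matrices. *)
Fixpoint tens n : ('I_n -> 'M[C]_2) -> 'M[C]_(dimn n) :=
  if n is n'.+1 then fun f => f ord0 *t tens (fun j => f (lift ord0 j))
  else fun=> 1%:M.

Lemma eq_tens n (f g : 'I_n -> 'M_2) : f =1 g -> tens f = tens g.
Proof.
elim: n f g => [|n IH] f g E //=; rewrite E; congr (_ *t _).
by apply: IH => j; apply: E.
Qed.

Lemma tens_mul n (f g : 'I_n -> 'M_2) :
  tens f *m tens g = tens (fun j => f j *m g j).
Proof.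
elim: n f g => [|n IH] f g /=; first by rewrite mulmx1.
by rewrite tensmx_mul IH.
Qed.

Lemma tens1 n : tens (fun _ : 'I_n => 1%:M) = 1%:M.
Proof. by elim: n => [|n IH] //=; rewrite IH tensmx11. Qed.

Lemma on1E n A (j : 'I_n) : on1 A j = tens (fun k => if k == j then A else 1%:M).
Proof.
elim: n j => [[]|n IH] // j /=; case: unliftP => [i ->|->].
  rewrite (negbTE (neq_lift _ _)) IH; congr (_ *t _).
by rewrite eqxx; congr (_ *t _); rewrite -(tens1 n); apply: eq_tens => k; rewrite lift_eqF.
Qed.

Lemma tens_scale n (j : 'I_n) c (f g : 'I_n -> 'M_2) :
  (forall k, g k = if k == j then c *: f k else f k) -> tens g = c *: tens f.
Proof.
elim: n j f g => [[]|n IH] // j f g E /=; rewrite E; case: (unliftP ord0 j) E => [i ->|->] E.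
  rewrite (negbTE (neq_lift _ _)) -tensmxZr; congr (_ *t _).
  by apply: (IH i) => k; rewrite E (inj_eq lift_inj).
rewrite eqxx tensmxZl; congr (_ *: (_ *t _)); apply: eq_tens => k.
by rewrite E lift_eqF.
Qed.

Lemma on1_mul n A B (j : 'I_n) : on1 A j *m on1 B j = on1 (A *m B) j :> 'M[C]_(dimn n).
Proof.
by rewrite !on1E tens_mul; apply: eq_tens => k; case: eqP; rewrite ?mulmx1.
Qed.

Lemma on1_comm n A B (j k : 'I_n) : j != k ->
  on1 A j *m on1 B k = on1 B k *m on1 A j :> 'M[C]_(dimn n).
Proof.
move=> jk; rewrite !on1E !tens_mul; apply: eq_tens => i.
by case: eqP => [->|]; rewrite ?(negbTE jk) ?mulmx1 ?mul1mx.
Qed.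

Lemma on1_1 n (j : 'I_n) : on1 1%:M j = 1%:M :> 'M[C]_(dimn n).
Proof. by rewrite on1E -(tens1 n); apply: eq_tens => k; case: eqP. Qed.

Lemma on1D n A B (j : 'I_n) : on1 (A + B) j = on1 A j + on1 B j :> 'M[C]_(dimn n).
Proof.
elim: n j => [[]|n IH] // j /=; case: unliftP => [i _|_]; last by rewrite tensmxDl.
by rewrite IH tensmxDr.
Qed.

Lemma on1Z n c A (j : 'I_n) : on1 (c *: A) j = c *: on1 A j :> 'M[C]_(dimn n).
Proof.
by rewrite !on1E; apply: (tens_scale (j := j)) => k; case: eqP.
Qed.

(** * Pauli operators and how Clifford gates permute them *)

Definition mxZ : 'M[C]_2 := diag_mx (\row_(a < 2) (-1) ^+ a).

Ltac mx2 := apply/matrixP=> -[[|[|?]] ?] // -[[|[|?]] ?] //;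
  rewrite /mxX /mxZ /mxH /mxS /mxP /mxT /mxTdg; rewrite !(mxE, big_ord_recl, big_ord0) /=;
  rewrite -?val_eqE /= ?(mulr0n, mulr1n, mul1r, mulr1, mul0r, mulr0, add0r, addr0, expr0, expr1).

Lemma mxXX : mxX C *m mxX C = 1%:M.
Proof. mx2=> //. Qed.

Lemma mxZZ : mxZ *m mxZ = 1%:M.
Proof. by mx2; rewrite ?mulrNN ?mulr1. Qed.

Lemma mxZX : mxZ *m mxX C = - 1 *: (mxX C *m mxZ).
Proof. by mx2; rewrite ?mulrN1 ?opprK ?oppr0 ?mulr1. Qed.

Definition pauli1 (a b : 'F_2) : 'M[C]_2 :=
  (if a == 0 then 1%:M else mxX C) *m (if b == 0 then 1%:M else mxZ).

Lemma F2_add11 : 1 + 1 = 0 :> 'F_2.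
Proof. exact: val_inj. Qed.

Ltac mx2F := rewrite /pauli1 ?addr0 ?add0r ?F2_add11 ?eqxx ?oner_eq0 ?(mul1mx, mulmx1) /=
  ?(expr0, expr1, scale1r) //; mx2; rewrite ?(mulN1r, mulrN1, mulNr, mulrN, oppr0, opprK) //.

Definition F2_sign (b : 'F_2) : C := (-1) ^+ b.

Lemma F2_signK b : F2_sign b * F2_sign b = 1.
Proof. by case: (F2_cases b) => ->; rewrite /F2_sign ?expr0 ?expr1 ?mulrNN mulr1. Qed.

Ltac f2case x := case: (F2_cases x) => ->.

Lemma mxH_pauli1 a b : mxH C *m pauli1 a b = (-1) ^+ (a * b)%N *: (pauli1 b a *m mxH C).
Proof. by f2case a; f2case b; mx2F. Qed.

Lemma mxS_pauli1 a b : mxS C *m pauli1 a b = 'i ^+ a *: (pauli1 a (a + b) *m mxS C).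
Proof. by f2case a; f2case b; mx2F; rewrite -expr2 sqrCi ?opprK. Qed.

(** This and the next three lemmas treat the control of a CNOT: [b'] is the Z exponent of the
    target, which gets added to that of the control, and an X on the control exchanges the two
    projectors. *)
Lemma P0_pauli1_0 b b' : mxP C 0 *m pauli1 0 b = pauli1 0 (b + b') *m mxP C 0.
Proof. by f2case b; f2case b'; mx2F. Qed.

Lemma P1_pauli1_0 b b' : mxP C 1 *m pauli1 0 b = F2_sign b' *: (pauli1 0 (b + b') *m mxP C 1).
Proof. by rewrite /F2_sign; f2case b; f2case b'; mx2F. Qed.

Lemma P0_pauli1_1 b b' : mxP C 0 *m pauli1 1 b = F2_sign b' *: (pauli1 1 (b + b') *m mxP C 1).
Proof. by rewrite /F2_sign; f2case b; f2case b'; mx2F. Qed.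

Lemma P1_pauli1_1 b b' : mxP C 1 *m pauli1 1 b = pauli1 1 (b + b') *m mxP C 0.
Proof. by f2case b; f2case b'; mx2F. Qed.

Lemma X_pauli1 a b : mxX C *m pauli1 a b = F2_sign b *: (pauli1 a b *m mxX C).
Proof. by rewrite /F2_sign; f2case a; f2case b; mx2F. Qed.

Lemma X_pauli1_add a b : mxX C *m pauli1 a b = pauli1 (a + 1) b.
Proof. by f2case a; f2case b; mx2F. Qed.

Lemma pauli1_mulX a b : pauli1 a b = F2_sign b *: (pauli1 (a + 1) b *m mxX C).
Proof. by rewrite /F2_sign; f2case a; f2case b; mx2F. Qed.

(** Serves the CNOT gate, where the signs appearing on control and target cancel each other. *)
Lemma tens_eq2 n (j k : 'I_n) c d (f g : 'I_n -> 'M_2) : j != k ->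
  f j = c *: g j -> f k = d *: g k -> c * d = 1 ->
  (forall i, i != j -> i != k -> f i = g i) -> tens f = tens g.
Proof.
move=> jk fj fk cd fg.
rewrite (@tens_scale _ j c (fun i => if i == j then g j else f i) f).
  rewrite -[RHS]scale1r -cd -scalerA; congr (_ *: _); apply: (@tens_scale _ k) => i.
  case: (eqVneq i k) => [->|ik]; first by rewrite eq_sym (negbTE jk) fk.
  by case: (eqVneq i j) => [-> //|ij]; rewrite fg.
by move=> i; case: eqP => [->|].
Qed.

(* [v] is the row vector [(x | z)] standing for [X^x Z^z]. *)
Definition pauli n (v : 'rV['F_2]_(n + n)) : 'M[C]_(dimn n) :=
  tens (fun k => pauli1 (lsubmx v 0 k) (rsubmx v 0 k)).

(** Stated as a commutation relation, so that no inverse of [U] appears. The scalar is left free, so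
    [M] records the action modulo phases only. *)
Definition acts n (U : 'M[C]_(dimn n)) (M : 'M['F_2]_(n + n)) :=
  forall v, exists l : C, U *m pauli v = l *: (pauli (v *m M) *m U).

Lemma acts1 n : acts (1%:M : 'M_(dimn n)) 1%:M.
Proof. by move=> v; exists 1; rewrite !mulmx1 mul1mx scale1r. Qed.

Lemma acts_mul n (U V : 'M_(dimn n)) M N :
  acts U M -> acts V N -> acts (U *m V) (N *m M).
Proof.
move=> HU HV v; have [l1 E1] := HV v; have [l2 E2] := HU (v *m N).
exists (l1 * l2); rewrite -mulmxA E1 -scalemxAr (mulmxA U) E2 -scalemxAl scalerA.
by rewrite (mulmxA v) -(mulmxA (pauli _)).
Qed.

Lemma row_mul_delta n (a : 'rV['F_2]_n) (j k i : 'I_n) :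
  (a *m delta_mx j k) 0 i = if i == k then a 0 j else 0.
Proof.
rewrite mxE (bigD1 j) //= mxE eqxx /= big1 => [|l /negbTE lj].
  by case: eqP; rewrite ?mulr1 ?mulr0 addr0.
by rewrite mxE lj mulr0.
Qed.

Definition gate_symp n (g : clifford_gate n) : 'M['F_2]_(n + n) :=
  match g with
  | GateH j => let D := delta_mx j j in block_mx (1%:M + D) D D (1%:M + D)
  | GateS j => block_mx 1%:M (delta_mx j j) 0 1%:M
  | GateCNOT j k _ => block_mx (1%:M + delta_mx j k) 0 0 (1%:M + delta_mx k j)
  end.

Lemma acts_on1 n (G : 'M[C]_2) j (M : 'M['F_2]_(n + n)) (l : 'F_2 -> 'F_2 -> C)
    (f : 'F_2 -> 'F_2 -> 'F_2 * 'F_2) :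
  (forall a b, G *m pauli1 a b = l a b *: (pauli1 (f a b).1 (f a b).2 *m G)) ->
  (forall (v : 'rV_(n + n)) k, (lsubmx (v *m M) 0 k, rsubmx (v *m M) 0 k) =
     if k == j then f (lsubmx v 0 k) (rsubmx v 0 k) else (lsubmx v 0 k, rsubmx v 0 k)) ->
  acts (on1 G j) M.
Proof.
move=> HG HM v; exists (l (lsubmx v 0 j) (rsubmx v 0 j)).
rewrite on1E !tens_mul; apply: (tens_scale (j := j)) => k.
have := HM v k; case: eqP => [->|_]; last by case=> -> ->; rewrite mulmx1 mul1mx.
by rewrite HG; case: (f _ _) => x y [-> ->].
Qed.

Lemma acts_CNOT n (j k : 'I_n) (jk : j != k) :
  acts (mxCNOT C j k) (gate_symp (GateCNOT jk)).
Proof.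
move=> v; exists 1; rewrite scale1r.
rewrite -(hsubmxK v) /= mul_row_block !mulmx0 add0r addr0 !mulmxDr !mulmx1 /pauli.
rewrite !row_mxKl !row_mxKr.
move: (lsubmx v) (rsubmx v) => a b.
have kj : k == j = false by rewrite eq_sym (negbTE jk).
have EA i : (a + a *m delta_mx j k) 0 i = a 0 i + (if i == k then a 0 j else 0).
  by rewrite mxE row_mul_delta.
have EB i : (b + b *m delta_mx k j) 0 i = b 0 i + (if i == j then b 0 k else 0).
  by rewrite mxE row_mul_delta.
have EO i : i != j -> i != k ->
    pauli1 ((a + a *m delta_mx j k) 0 i) ((b + b *m delta_mx k j) 0 i) = pauli1 (a 0 i) (b 0 i).
  by move=> /negbTE ij /negbTE ik; rewrite EA EB ij ik !addr0.
rewrite /mxCNOT !on1E mulmxDl !tens_mul.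
(* An X on the control exchanges its projectors, so for [a 0 j = 1] the summands on the two sides
   match crosswise. *)
case: (F2_cases (a 0 j)) => aj; last rewrite [RHS]addrC; congr (_ + _).
- apply: (tens_eq2 (j := j) (k := k) (c := 1) (d := 1)) => //; rewrite ?mulr1 ?scale1r //.
  + by rewrite eqxx EA EB eqxx (negbTE jk) addr0 aj -P0_pauli1_0.
  + by rewrite kj mulmx1 mul1mx EA EB eqxx aj kj !addr0.
  by move=> i ij ik; rewrite EO // (negbTE ij) mulmx1 mul1mx.
- apply: (tens_eq2 (j := j) (k := k) (c := F2_sign (b 0 k)) (d := F2_sign (b 0 k))) => //.
  + by rewrite eqxx (negbTE jk) !mulmx1 EA EB eqxx (negbTE jk) addr0 aj -P1_pauli1_0.
  + by rewrite kj !mul1mx eqxx EA EB eqxx aj kj !addr0 X_pauli1.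
  + exact: F2_signK.
  by move=> i ij ik; rewrite EO // (negbTE ij) (negbTE ik) !mulmx1 mul1mx.
- apply: (tens_eq2 (j := j) (k := k) (c := F2_sign (b 0 k)) (d := F2_sign (b 0 k))) => //.
  + by rewrite eqxx (negbTE jk) !mulmx1 EA EB eqxx (negbTE jk) addr0 aj -P0_pauli1_1.
  + by rewrite kj !mul1mx eqxx EA EB eqxx aj kj !addr0 -pauli1_mulX.
  + exact: F2_signK.
  by move=> i ij ik; rewrite EO // (negbTE ij) (negbTE ik) !mulmx1 mul1mx.
apply: (tens_eq2 (j := j) (k := k) (c := 1) (d := 1)) => //; rewrite ?mulr1 ?scale1r //.
- by rewrite eqxx (negbTE jk) !mulmx1 EA EB eqxx (negbTE jk) addr0 aj -P1_pauli1_1.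
- by rewrite kj !mul1mx mulmx1 eqxx EA EB eqxx aj kj !addr0 X_pauli1_add.
by move=> i ij ik; rewrite EO // (negbTE ij) (negbTE ik) !mulmx1 mul1mx.
Qed.

Lemma acts_H n (j : 'I_n) : acts (on1 (mxH C) j) (gate_symp (GateH j)).
Proof.
apply: (acts_on1 (l := fun a b => (-1) ^+ (a * b)%N) (f := fun a b => (b, a))) => [a b|v k].
  exact: mxH_pauli1.
rewrite -(hsubmxK v) /= mul_row_block !row_mxKl !row_mxKr !mulmxDr !mulmx1.
move: (lsubmx v) (rsubmx v) => a b.
rewrite ![(_ + _ : 'M_(_, _)) _ _]mxE !row_mul_delta; case: eqP => [->|_]; last by rewrite !addr0 add0r.
by f2case (a 0 j); f2case (b 0 j); rewrite ?addr0 ?add0r ?F2_add11 ?add0r ?addr0.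
Qed.

Lemma acts_S n (j : 'I_n) : acts (on1 (mxS C) j) (gate_symp (GateS j)).
Proof.
apply: (acts_on1 (l := fun a b => 'i ^+ a) (f := fun a b => (a, a + b))) => [a b|v k].
  exact: mxS_pauli1.
rewrite -(hsubmxK v) /= mul_row_block !row_mxKl !row_mxKr !mulmx1 mulmx0 addr0.
rewrite ![(_ + _ : 'M_(_, _)) _ _]mxE !row_mul_delta.
by case: eqP => [->|_]; rewrite ?add0r.
Qed.

Lemma acts_gate n (g : clifford_gate n) : acts (clifford_gate_mx C g) (gate_symp g).
Proof. by case: g => [j|j|j k jk]; [exact: acts_H | exact: acts_S | exact: acts_CNOT]. Qed.

(* Matrices act on row vectors, so the product is in time order, unlike in [circuit_mx]. *)
Definition symp n (c : clifford_circuit n) : 'M['F_2]_(n + n) :=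
  foldr (fun g M => gate_symp g *m M) 1%:M c.

Lemma acts_circuit n (c : clifford_circuit n) : acts (clifford_mx C c) (symp c).
Proof.
elim: c => [|g c IH] /=; first exact: acts1.
by apply: acts_mul => //; exact: acts_gate.
Qed.

Lemma circuit_mx_cat n (c1 c2 : circuit n) :
  circuit_mx C (c1 ++ c2) = circuit_mx C c2 *m circuit_mx C c1.
Proof. by elim: c1 => [|g c1 IH] /=; rewrite ?mulmx1 // IH mulmxA. Qed.

Lemma clifford_mx_cat n (c1 c2 : clifford_circuit n) :
  clifford_mx C (c1 ++ c2) = clifford_mx C c2 *m clifford_mx C c1.
Proof. by rewrite /clifford_mx map_cat circuit_mx_cat. Qed.
End Tensor.

Lemma symp_cat n (c1 c2 : clifford_circuit n) : symp (c1 ++ c2) = symp c1 *m symp c2.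
Proof. by elim: c1 => [|g c1 IH] /=; rewrite ?mul1mx // IH mulmxA. Qed.

(** * Roots of unity in Q(omega) *)

(** The 2-adic valuations of the two sides of [2 p^2 = q^2] have different parity. *)
Lemma rat_sqr_half (a : rat) : 2 * a ^+ 2 != 1.
Proof.
apply/eqP => H.
have E : 2 * numq a ^+ 2 = denq a ^+ 2.
  apply: (@intr_inj rat); rewrite rmorphM !rmorphXn /= numqE.
  by rewrite exprMn mulrA H mul1r.
have E2 : (2 * `|numq a| ^ 2 = `|denq a| ^ 2)%N by rewrite -!abszX -E abszM.
have n0 : (0 < `|numq a|)%N.
  rewrite absz_gt0 numq_eq0; apply/eqP => a0; move/eqP: H.
  by rewrite a0 expr0n mulr0 eq_sym oner_eq0.
have := congr1 (logn 2) E2; rewrite lognM ?expn_gt0 ?n0 // !lognX => /(congr1 odd).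
by rewrite oddD !oddM.
Qed.

Section Roots.
Variable C : numClosedFieldType.
Local Notation w := (omega C).

Definition in_Qi (x : C) := exists a b : rat, x = ratr a + ratr b * 'i.

Lemma in_QiD x y : in_Qi x -> in_Qi y -> in_Qi (x + y).
Proof.
by move=> [a [b ->]] [c [d ->]]; exists (a + c), (b + d); rewrite !rmorphD /=; ring.
Qed.

Lemma in_QiM x y : in_Qi x -> in_Qi y -> in_Qi (x * y).
Proof.
move=> [a [b ->]] [c [d ->]]; exists (a * c - b * d), (a * d + b * c).
rewrite !(rmorphD, rmorphN, rmorphM) /=.
have ii : 'i * 'i = -1 :> C by rewrite -expr2 sqrCi.
transitivity (ratr a * ratr c + ratr b * ratr d * ('i * 'i) + (ratr a * ratr d + ratr b * ratr c) * 'i : C).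
  by ring.
by rewrite ii; ring.
Qed.

Lemma in_Qi_rat a : in_Qi (ratr a).
Proof. by exists a, 0; rewrite rmorph0; ring. Qed.

Lemma in_Qi_nat n : in_Qi n%:R.
Proof. by rewrite -(ratr_nat C); exact: in_Qi_rat. Qed.

Lemma in_Qi_i : in_Qi 'i.
Proof. by exists 0, 1; rewrite rmorph0 rmorph1; ring. Qed.

Lemma in_QiN x : in_Qi x -> in_Qi (- x).
Proof. by move=> [a [b ->]]; exists (- a), (- b); rewrite !rmorphN /=; ring. Qed.

Lemma Qi_eq0 (a b : rat) : ratr a + ratr b * 'i = 0 :> C -> a = 0 /\ b = 0.
Proof.
move=> H; suff b0 : b = 0.
  by move: H; rewrite b0 rmorph0 mul0r addr0 => /eqP; rewrite fmorph_eq0 => /eqP.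
have H2 : ratr (a ^+ 2 + b ^+ 2) = 0 :> C.
  rewrite rmorphD !rmorphXn /=; transitivity ((ratr a + ratr b * 'i) * (ratr a - ratr b * 'i) : C).
    have ii : 'i * 'i = -1 :> C by rewrite -expr2 sqrCi.
    transitivity (ratr a ^+ 2 - ratr b ^+ 2 * ('i * 'i) : C); last by ring.
    by rewrite ii; ring.
  by rewrite H mul0r.
move/eqP: H2; rewrite fmorph_eq0 paddr_eq0 ?sqr_ge0 // !sqrf_eq0 => /andP[_ /eqP //].
Qed.

Lemma in_QiV x : in_Qi x -> in_Qi x^-1.
Proof.
move=> [a [b Ex]]; have [->|x0] := eqVneq x 0; first by rewrite invr0; exact: (in_Qi_nat 0).
pose N : rat := a ^+ 2 + b ^+ 2.
have EN : ratr N = x * (ratr a - ratr b * 'i).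
  rewrite Ex rmorphD !rmorphXn /=.
  have ii : 'i * 'i = -1 :> C by rewrite -expr2 sqrCi.
  transitivity (ratr a ^+ 2 - ratr b ^+ 2 * ('i * 'i) : C); last by ring.
  by rewrite ii; ring.
have N0 : ratr N != 0 :> C.
  rewrite fmorph_eq0 paddr_eq0 ?sqr_ge0 // !sqrf_eq0; apply/negP => /andP[/eqP a0 /eqP b0].
  by move: x0; rewrite Ex a0 b0 rmorph0 mul0r addr0 eqxx.
have -> : x^-1 = (ratr a + ratr (- b) * 'i) * ratr N^-1.
  rewrite fmorphV; apply: (mulfI x0); rewrite mulfV // mulrA rmorphN mulNr -EN mulfV //.
by apply: in_QiM; [exists a, (- b) | exact: in_Qi_rat].
Qed.

(** For [e = 1] or [e = -1], comparing coefficients in [(a + b i)^2 = e i] gives [a^2 = b^2] and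
    [2 a b = e]. Hence [(2 a^2)^2 = 1], and then [2 a^2 = 1] with [a] rational. *)
Lemma Qi_sqr_neq_i z : in_Qi z -> z ^+ 2 != 'i /\ z ^+ 2 != - 'i.
Proof.
have key z' (e : rat) : e ^+ 2 = 1 -> in_Qi z' -> z' ^+ 2 = ratr e * 'i -> False.
  move=> e1 [a [b ->]] H.
  have [] := @Qi_eq0 (a ^+ 2 - b ^+ 2) (2 * a * b - e).
    rewrite !(rmorphD, rmorphN, rmorphM, rmorphXn, rmorph1) /= mulrBl -H.
    have ii : 'i * 'i = -1 :> C by rewrite -expr2 sqrCi.
    transitivity (- ratr b ^+ 2 * (1 + 'i * 'i) : C); last by rewrite ii subrr mulr0.
    by ring.
  move/eqP; rewrite subr_eq0 => /eqP ab /eqP; rewrite subr_eq0 => /eqP ab2.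
  have : (2 * a ^+ 2) ^+ 2 = 1.
    have -> : (2 * a ^+ 2) ^+ 2 = (2 * a * b) ^+ 2 by rewrite expr2 {2}ab; ring.
    by rewrite ab2.
  move/eqP; rewrite sqrf_eq1 (negbTE (rat_sqr_half a)) /= => /eqP H2.
  have : 0 <= 2 * a ^+ 2 by rewrite mulr_ge0 ?sqr_ge0.
  by rewrite H2.
move=> Hz; split; apply/eqP => H.
  by apply: (@key z 1) => //; rewrite ?expr1n // rmorph1 mul1r.
by apply: (@key z (-1)) => //; rewrite ?sqrrN ?expr1n // rmorphN1 mulN1r.
Qed.

Lemma omega_sqr : w ^+ 2 = 'i.
Proof.
rewrite /omega expr_div_n sqrtCK sqrrD sqrCi expr1n mul1r addrAC subrr add0r.
by rewrite -mulr_natr mulfK // pnatr_eq0.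
Qed.

Lemma omega4 : w ^+ 4 = -1.
Proof. by rewrite (exprM _ 2 2) omega_sqr sqrCi. Qed.

(** If [y] were nonzero, [w] would be an element of Q(i) with square ['i]. *)
Lemma omega_indep x y : in_Qi x -> in_Qi y -> x + y * w = 0 -> x = 0 /\ y = 0.
Proof.
move=> Hx Hy E; have [y0|y0] := eqVneq y 0.
  by move: E; rewrite y0 mul0r addr0.
have Ew : w = - x * y^-1.
  by apply: (mulfI y0); rewrite mulrC mulrCA mulfV // mulr1; apply/eqP; rewrite -addr_eq0 addrC mulrC E.
have [] := @Qi_sqr_neq_i w.
  by rewrite Ew; apply: in_QiM; [exact: in_QiN | exact: in_QiV].
by rewrite omega_sqr eqxx.
Qed.

Definition in_Qw (z : C) := exists x y, [/\ in_Qi x, in_Qi y & z = x + y * w].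

Lemma in_QwD x y : in_Qw x -> in_Qw y -> in_Qw (x + y).
Proof.
move=> [a [b [Ha Hb ->]]] [c [d [Hc Hd ->]]]; exists (a + c), (b + d).
split; [exact: in_QiD | exact: in_QiD | ring].
Qed.

Lemma in_QwM x y : in_Qw x -> in_Qw y -> in_Qw (x * y).
Proof.
move=> [a [b [Ha Hb ->]]] [c [d [Hc Hd ->]]]; exists (a * c + b * d * 'i), (a * d + b * c).
split; [|by apply: in_QiD; exact: in_QiM|rewrite -omega_sqr; ring].
by apply: in_QiD; [|apply: in_QiM; [|exact: in_Qi_i]]; exact: in_QiM.
Qed.

Lemma in_Qw_Qi x : in_Qi x -> in_Qw x.
Proof. by move=> Hx; exists x, 0; split=> //; [exact: (in_Qi_nat 0) | ring]. Qed.

Lemma in_Qw_root z : in_Qw z -> z ^+ 16 = 1 -> z ^+ 8 = 1.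
Proof.
(* If [z^8 = -1] then [z^2 = e w] with [e] a power of ['i]; comparing coefficients of
   [z = x + y w] gives [(x / y)^2 = -'i], impossible in Q(i). *)
move=> [x [y [Hx Hy Ez]]]; rewrite (exprM z 8 2) => /eqP; rewrite sqrf_eq1.
case/orP => [/eqP //|/eqP z8].
have [e [He e0 Ee]] : exists e, [/\ in_Qi e, e != 0 & z ^+ 2 = e * w].
  move: z8; rewrite (exprM z 2 4) (exprM _ 2 2) -sqrCi => /eqP; rewrite eqf_sqr.
  have i0 : 'i != 0 :> C by exact: neq0Ci.
  case/orP => [|]; rewrite -omega_sqr.
    rewrite eqf_sqr => /orP[] /eqP ->.
      by exists 1; rewrite mul1r oner_eq0; split=> //; exact: (in_Qi_nat 1).
    exists (-1); rewrite mulN1r oppr_eq0 oner_eq0; split=> //.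
    by apply: in_QiN; exact: (in_Qi_nat 1).
  rewrite -mulN1r -sqrCi -exprMn eqf_sqr => /orP[] /eqP ->.
    by exists 'i; split=> //; exact: in_Qi_i.
  by exists (- 'i); rewrite mulNr oppr_eq0; split=> //; apply: in_QiN; exact: in_Qi_i.
have [|||E1 E2] := @omega_indep (x ^+ 2 + 'i * y ^+ 2) (2 * x * y - e).
- by rewrite !expr2; apply: in_QiD; [exact: in_QiM | apply: in_QiM; [exact: in_Qi_i | exact: in_QiM]].
- apply: in_QiD; last exact: in_QiN.
  by apply: in_QiM => //; apply: in_QiM => //; exact: (in_Qi_nat 2).
- by rewrite mulrBl -Ee Ez -omega_sqr; ring.
have y0 : y != 0.
  by apply: contraNneq e0 => y0; move/eqP: E2; rewrite y0 mulr0 sub0r oppr_eq0.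
have [_] := @Qi_sqr_neq_i (x / y) (in_QiM Hx (in_QiV Hy)).
rewrite expr_div_n; move/eqP: E1; rewrite addr_eq0 => /eqP ->.
by rewrite -mulNr mulfK ?eqxx // sqrf_eq0.
Qed.

Lemma in_QwX z n : in_Qw z -> in_Qw (z ^+ n).
Proof.
move=> Hz; elim: n => [|n IH]; first by apply/in_Qw_Qi/(in_Qi_nat 1).
by rewrite exprS; exact: in_QwM.
Qed.

(** Applied to successive squares, which stay in Q(omega), [in_Qw_root] brings the exponent down to
    8. As [w ^+ 4 = -1], the order of [w] is exactly 8, so its powers are all the eighth roots of
    unity. *)
Lemma in_Qw_root8 z m : in_Qw z -> z ^+ (2 ^ m) = 1 -> exists k, (k < 8)%N /\ z = w ^+ k.
Proof.
move=> Hz Hm.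
have z8 : z ^+ 8 = 1.
  elim: m z Hz Hm => [|m IH] z Hz; first by rewrite expr1 => ->; rewrite expr1n.
  rewrite expnS exprM => /(IH _ (in_QwX 2 Hz)); rewrite -exprM => H.
  exact: in_Qw_root.
have w8 : w ^+ 8 = 1 by rewrite (exprM _ 4 2) omega4 sqrrN expr1n.
have [k primk k8] := prim_order_exists (isT : (0 < 8)%N) w8.
suff k_8 : k = 8%N.
  by move: primk; rewrite k_8 => prim; have [i Hi] := prim_rootP prim z8; exists i.
have : k \in divisors 8 by rewrite -dvdn_divisors.
have w4 : w ^+ 4 != 1 by rewrite omega4 eqNr oner_eq0.
have Hk d : (k * d = 4)%N -> False.
  by move=> E; move: w4; rewrite -E exprM (prim_expr_order primk) expr1n eqxx.
rewrite !inE => /or4P[] /eqP Ek //.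
- by case: (Hk 4); rewrite Ek.
- by case: (Hk 2); rewrite Ek.
- by case: (Hk 1%N); rewrite Ek.
Qed.
End Roots.

(** * Scalar Clifford circuits *)

Section Scalars.
Variable C : numClosedFieldType.

Definition mx_in_Qw m n (M : 'M[C]_(m, n)) := forall i j, in_Qw (M i j).

Lemma in_Qw_nat n : in_Qw (n%:R : C).
Proof. exact/in_Qw_Qi/in_Qi_nat. Qed.

Lemma mx_in_Qw1 n : mx_in_Qw (1%:M : 'M_n).
Proof. by move=> i j; rewrite mxE; exact: in_Qw_nat. Qed.

Lemma mx_in_QwM m n p (A : 'M_(m, n)) (B : 'M_(n, p)) :
  mx_in_Qw A -> mx_in_Qw B -> mx_in_Qw (A *m B).
Proof.
move=> HA HB i j; rewrite mxE; apply: big_ind; first exact: (in_Qw_nat 0).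
  exact: in_QwD.
by move=> k _; exact: in_QwM.
Qed.

Lemma mx_in_Qw_tens n (f : 'I_n -> 'M_2) :
  (forall k, mx_in_Qw (f k)) -> mx_in_Qw (tens f).
Proof.
elim: n f => [|n IH] f Hf /=; first exact: mx_in_Qw1.
by move=> i j; rewrite mxE; apply: in_QwM; [exact: Hf | apply: IH].
Qed.

Lemma mx_in_Qw_on1 n (A : 'M_2) (j : 'I_n) : mx_in_Qw A -> mx_in_Qw (on1 A j).
Proof.
move=> HA; rewrite on1E; apply: mx_in_Qw_tens => k; case: eqP => // _; exact: mx_in_Qw1.
Qed.

(** Exhibits the normalisation of the Hadamard gate as an element of Q(omega). *)
Lemma invsqrt2E : (sqrtC 2)^-1 = omega C * (1 - 'i) / 2.
Proof.
have ii : 'i * 'i = -1 :> C by rewrite -expr2 sqrCi.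
have -> : omega C * (1 - 'i) = 2 / sqrtC 2.
  rewrite /omega mulrAC; congr (_ / _).
  transitivity (1 - 'i * 'i : C).
  by ring.
  by rewrite ii; ring.
by rewrite mulrAC divff ?mul1r // pnatr_eq0.
Qed.

Lemma mx_in_QwH : mx_in_Qw (mxH C).
Proof.
move=> i j; rewrite !mxE; apply: in_QwM.
  rewrite invsqrt2E; apply: in_QwM; last by apply/in_Qw_Qi/in_QiV/in_Qi_nat.
  apply: in_QwM; first by exists 0, 1; split; [exact: (in_Qi_nat _ 0) | exact: (in_Qi_nat _ 1) | ring].
  apply/in_Qw_Qi/in_QiD; first exact: (in_Qi_nat _ 1).
  by apply: in_QiN; exact: in_Qi_i.
by apply/in_QwX/in_Qw_Qi/in_QiN; exact: (in_Qi_nat _ 1).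
Qed.

Lemma mx_in_QwS : mx_in_Qw (mxS C).
Proof.
move=> i j; rewrite !mxE; case: eqP => _; last exact: (in_Qw_nat 0).
by rewrite mulr1n; apply/in_QwX/in_Qw_Qi/in_Qi_i.
Qed.

Lemma mx_in_Qw_clifford n (c : clifford_circuit n) : mx_in_Qw (clifford_mx C c).
Proof.
elim: c => [|g c IH]; first exact: mx_in_Qw1.
apply: mx_in_QwM => //; case: g => [j|j|j k jk] /=.
- exact/mx_in_Qw_on1/mx_in_QwH.
- exact/mx_in_Qw_on1/mx_in_QwS.
have HP a : mx_in_Qw (mxP C a) by move=> x y; rewrite !mxE; exact: in_Qw_nat.
have HX : mx_in_Qw (mxX C) by move=> x y; rewrite !mxE; exact: in_Qw_nat.
move=> x y; rewrite mxE; apply: in_QwD; first exact: mx_in_Qw_on1.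
by apply: mx_in_QwM; exact: mx_in_Qw_on1.
Qed.

Lemma mxHH : mxH C *m mxH C = 1%:M.
Proof.
have H : (sqrtC 2)^-1 * (sqrtC 2)^-1 = 2^-1 :> C by rewrite -invfM -expr2 sqrtCK.
have H2 : 2^-1 + 2^-1 = 1 :> C.
    have n2 : 2 != 0 :> C by rewrite pnatr_eq0.
    by rewrite -[RHS](divff n2) -[X in X / _]/(1 + 1) mulrDl mul1r.
rewrite /mxH -scalemxAl -scalemxAr scalerA H.
apply/matrixP=> -[[|[|?]] ?] // -[[|[|?]] ?] //;
 rewrite !(mxE, big_ord_recl, big_ord0) /= ?(expr0, expr1, mulr1, mul1r, addr0, mulrN1, mulN1r, opprK)
   ?(subrr, mulr0, mulrDr, mulr1) //.
 all: by rewrite mulrN1 subrr.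
Qed.

Lemma mxSS : mxS C *m mxS C = mxZ C.
Proof.
apply/matrixP=> -[[|[|?]] ?] // -[[|[|?]] ?] //;
 rewrite !(mxE, big_ord_recl, big_ord0) /=
   ?(mulr0n, mulr1n, expr0, expr1, mulr1, mul1r, addr0, mulr0, mul0r, add0r) //.
by rewrite -expr2 sqrCi.
Qed.

Lemma mxP01 : mxP C 0 + mxP C 1 = 1%:M.
Proof.
by apply/matrixP=> -[[|[|?]] ?] // -[[|[|?]] ?] //; rewrite !mxE /= ?addr0 ?add0r.
Qed.

Lemma CNOT_mulK n (j k : 'I_n) : j != k -> mxCNOT C j k *m mxCNOT C j k = 1%:M.
Proof.
move=> jk; rewrite /mxCNOT mulmxDl !mulmxDr.
have PP a : on1 (mxP C a) j *m on1 (mxP C a) j = on1 (mxP C a) j.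
  by rewrite on1_mul mul_delta_mx.
have P0 a b : a != b -> on1 (mxP C a) j *m on1 (mxP C b) j = 0.
  by move=> ab; rewrite on1_mul mul_delta_mx_0 // -(scale0r 0) on1Z scale0r.
rewrite PP mulmxA P0 // mul0mx addr0.
have XP a : on1 (mxX C) k *m on1 (mxP C a) j = on1 (mxP C a) j *m on1 (mxX C) k.
  by rewrite on1_comm // eq_sym.
rewrite -[_ *m on1 (mxP C 0) j]mulmxA XP mulmxA P0 // mul0mx add0r.
rewrite -mulmxA [on1 (mxX C) k *m (_ *m _)]mulmxA XP -mulmxA on1_mul mxXX on1_1 mulmx1.
by rewrite PP -on1D mxP01 on1_1.
Qed.

Definition clifford_gate_inv n (g : clifford_gate n) : clifford_circuit n :=
  match g with
  | GateS j => [:: GateS j; GateS j; GateS j]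
  | g' => [:: g']
  end.

Definition clifford_inv n (c : clifford_circuit n) : clifford_circuit n :=
  flatten (rev (map (@clifford_gate_inv n) c)).

Lemma clifford_gate_invK n (g : clifford_gate n) :
  clifford_mx C (clifford_gate_inv g) *m clifford_gate_mx C g = 1%:M.
Proof.
case: g => [j|j|j k jk] /=; rewrite /clifford_mx /= !mul1mx.
- by rewrite on1_mul mxHH on1_1.
- by rewrite -mulmxA !on1_mul mxSS mxZZ on1_1.
- exact: CNOT_mulK.
Qed.

Lemma clifford_invK n (c : clifford_circuit n) :
  clifford_mx C (clifford_inv c) *m clifford_mx C c = 1%:M.
Proof.
elim: c => [|g c IH]; first by rewrite mul1mx.
rewrite /clifford_inv /= rev_cons flatten_rcons clifford_mx_cat -/(clifford_inv c).
have -> : clifford_mx C (g :: c) = clifford_mx C c *m clifford_gate_mx C g by [].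
by rewrite -mulmxA (mulmxA (clifford_mx C (clifford_inv c))) IH mul1mx clifford_gate_invK.
Qed.

Lemma dimnE n : dimn n = (2 ^ n)%N.
Proof. by elim: n => //= n ->; rewrite expnS. Qed.

(** The fourth power of every Clifford gate is the identity. *)
Lemma det_clifford n (c : clifford_circuit n) : \det (clifford_mx C c) ^+ 4 = 1.
Proof.
elim: c => [|g c IH]; first by rewrite det1 expr1n.
rewrite /clifford_mx /= det_mulmx exprMn IH mul1r.
case: g => [j|j|j k jk] /=; rewrite (exprM _ 2 2) [\det _ ^+ 2]expr2 -det_mulmx.
- by rewrite on1_mul mxHH on1_1 det1 expr1n.
- by rewrite on1_mul mxSS expr2 -det_mulmx on1_mul mxZZ on1_1 det1.
- by rewrite CNOT_mulK // det1 expr1n.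
Qed.

Lemma clifford_scalar n (c : clifford_circuit n) a :
  clifford_mx C c = a%:M -> exists k, (k < 8)%N /\ a = omega C ^+ k.
Proof.
move=> E; have dn : (0 < dimn n)%N by rewrite dimnE expn_gt0.
(* The determinant of the scalar matrix is [a ^+ (2 ^ n)], and its fourth power is 1; this accounts
   for [n + 2]. The scalar is itself a matrix entry, hence in Q(omega). *)
apply: (@in_Qw_root8 _ _ (n + 2)).
  have := mx_in_Qw_clifford c (Ordinal dn) (Ordinal dn).
  by rewrite E mxE eqxx mulr1n.
by rewrite expnD exprM -dimnE -(det_scalar (dimn n) a) -E det_clifford.
Qed.
End Scalars.

(** Even S becomes an involution modulo Pauli operators, because its square is Z. *)
Lemma gate_sympK n (g : clifford_gate n) : gate_symp g *m gate_symp g = 1%:M.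
Proof.
case: g => [j|j|j k jk] /=.
- rewrite mulmx_block !mulmxDr !mulmxDl !mulmx1 !mul1mx !mul_delta_mx.
  rewrite !mxF2_addxx !addr0 -addrA mxF2_addxx addr0 addrCA mxF2_addxx addr0.
  by rewrite -scalar_mx_block.
- by rewrite -/(umx _) -umx_add mxF2_addxx umx0.
rewrite mulmx_block !mulmx0 !mul0mx !addr0 !add0r !mulmxDr !mulmxDl !mulmx1 !mul1mx.
rewrite !mul_delta_mx_0 // 1?eq_sym // !addr0 -!addrA !mxF2_addxx !addr0.
by rewrite -scalar_mx_block.
Qed.

Lemma symp_inv n (c : clifford_circuit n) : symp c *m symp (clifford_inv c) = 1%:M.
Proof.
elim: c => [|g c IH]; first by rewrite mul1mx.
rewrite /clifford_inv /= rev_cons flatten_rcons symp_cat -/(clifford_inv c).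
rewrite -mulmxA [symp c *m _]mulmxA IH mul1mx.
have -> : symp (clifford_gate_inv g) = gate_symp g.
  case: g => [j|j|j k jk] /=; rewrite ?mulmx1 //.
  by rewrite -/(gate_symp (GateS j)) gate_sympK mulmx1.
exact: gate_sympK.
Qed.

(** * Clifford circuits acting trivially on Pauli operators *)

Section Schur.
Variable C : numClosedFieldType.

Lemma on1_ord0 n (A : 'M[C]_2) : on1 A (ord0 : 'I_n.+1) = A *t 1%:M.
Proof. by rewrite /= unlift_none. Qed.

Lemma on1_lift n (A : 'M[C]_2) (j : 'I_n) : on1 A (lift ord0 j) = 1%:M *t on1 A j.
Proof. by rewrite /= liftK. Qed.

Definition tens_block d (a b : 'I_2) (M : 'M[C]_(2 * d)) : 'M_d :=
  \matrix_(i, j) M (mxtens_index (a, i)) (mxtens_index (b, j)).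

Lemma tens_block_inj d (M N : 'M[C]_(2 * d)) : (forall a b, tens_block a b M = tens_block a b N) -> M = N.
Proof.
move=> E; apply/matrixP=> i j; case: (mxtens_indexP i) => a k; case: (mxtens_indexP j) => b l.
by have /matrixP/(_ k l) := E a b; rewrite !mxE.
Qed.

Lemma tens_block_tens d (a b : 'I_2) (A : 'M[C]_2) (B : 'M_d) : tens_block a b (A *t B) = A a b *: B.
Proof. by apply/matrixP=> i j; rewrite mxE tensmxE mxE. Qed.

Lemma tens_block_mul d (a b : 'I_2) (M N : 'M[C]_(2 * d)) :
  tens_block a b (M *m N) = \sum_c tens_block a c M *m tens_block c b N.
Proof.
apply/matrixP=> i j; rewrite summxE !mxE.
rewrite (reindex (@mxtens_index 2 d)) /=; last first.
  by exists (@mxtens_unindex 2 d) => k _; rewrite ?mxtens_indexK ?mxtens_unindexK.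
under [RHS]eq_bigr do rewrite mxE.
rewrite pair_bigA /=; apply: eq_bigr => -[c k] _ /=; by rewrite !mxE.
Qed.

(** Commuting with Z on the first qubit kills the off-diagonal blocks, and commuting with X there
    makes the diagonal blocks equal. The common block inherits the hypotheses on the remaining
    qubits. *)
Lemma schur n (M : 'M[C]_(dimn n)) :
  (forall j, M *m on1 (mxX C) j = on1 (mxX C) j *m M) ->
  (forall j, M *m on1 (mxZ C) j = on1 (mxZ C) j *m M) -> exists a, M = a%:M.
Proof.
elim: n M => [|n IH] M HX HZ; first by exists (M 0 0); exact: mx11_scalar.
have HX0 := HX ord0; have HZ0 := HZ ord0; rewrite !on1_ord0 in HX0 HZ0.
pose o1 : 'I_2 := lift ord0 ord0.
have eX a b := congr1 (@tens_block _ a b) HX0; have eZ a b := congr1 (@tens_block _ a b) HZ0.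
have D2 (N : 'M[C]_(dimn n)) : - N = N -> N = 0.
  move=> E; apply/matrixP=> i j; move/matrixP/(_ i j): E; rewrite !mxE => /eqP.
  by rewrite eq_sym -addr_eq0 -mulr2n mulrn_eq0 /= => /eqP.
have b01 : tens_block ord0 o1 M = 0.
  apply: D2; have := eZ ord0 o1; rewrite !tens_block_mul !big_ord_recl !big_ord0 !tens_block_tens !mxE /=.
  by rewrite !(mulr0n, mulr1n, expr0, expr1) !scale0r !mul0mx !mulmx0 scale1r mul1mx
    scaleN1r mulmxN mulmx1 !addr0 add0r.
have b10 : tens_block o1 ord0 M = 0.
  apply: D2; have := eZ o1 ord0; rewrite !tens_block_mul !big_ord_recl !big_ord0 !tens_block_tens !mxE /=.
  by rewrite !(mulr0n, mulr1n, expr0, expr1) !scale0r !mul0mx !mulmx0 scale1r mulmx1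
    scaleN1r mulNmx mul1mx !addr0 add0r.
have b11 : tens_block o1 o1 M = tens_block ord0 ord0 M.
  have := eX ord0 o1; rewrite !tens_block_mul !big_ord_recl !big_ord0 !tens_block_tens !mxE /=.
  by rewrite !scale0r !mul0mx !mulmx0 !scale1r mul1mx mulmx1 !addr0 add0r.
have [||a Ea] := IH (tens_block ord0 ord0 M).
- move=> j; have /(congr1 (@tens_block _ ord0 ord0)) := HX (lift ord0 j); rewrite on1_lift.
  rewrite !tens_block_mul !big_ord_recl !big_ord0 !tens_block_tens !mxE /=.
  by rewrite !scale0r mul0mx mulmx0 !scale1r !addr0.
- move=> j; have /(congr1 (@tens_block _ ord0 ord0)) := HZ (lift ord0 j); rewrite on1_lift.
  rewrite !tens_block_mul !big_ord_recl !big_ord0 !tens_block_tens !mxE /=.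
  by rewrite !scale0r mul0mx mulmx0 !scale1r !addr0.
have ord2 (x : 'I_2) : x = ord0 \/ x = o1.
  by case: x => [[|[|x]] Hx] //; [left | right]; apply: val_inj.
exists a; rewrite -scalemx1 -tensmx11 -tensmxZr; apply: tens_block_inj => x y.
rewrite tens_block_tens scalemx1.
case: (ord2 x) => ->; case: (ord2 y) => ->; rewrite ?b01 ?b10 ?b11 ?Ea !mxE /= ?scale0r ?scale1r //.
Qed.

Lemma mx1_neq0 n : (1%:M : 'M[C]_(dimn n)) != 0.
Proof.
have dn : (0 < dimn n)%N by rewrite dimnE expn_gt0.
apply/eqP => /matrixP/(_ (Ordinal dn) (Ordinal dn)); rewrite !mxE eqxx => /eqP.
by rewrite oner_eq0.
Qed.

Lemma pauli_X n (j : 'I_n) : pauli C (row_mx (delta_mx 0 j) 0) = on1 (mxX C) j.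
Proof.
rewrite on1E; apply: eq_tens => k; rewrite row_mxKl row_mxKr !mxE /pauli1 eqxx mulmx1 /=.
by case: (k == j).
Qed.

Lemma pauli_Z n (j : 'I_n) : pauli C (row_mx 0 (delta_mx 0 j)) = on1 (mxZ C) j.
Proof.
rewrite on1E; apply: eq_tens => k; rewrite row_mxKl row_mxKr !mxE /pauli1 eqxx mul1mx /=.
by case: (k == j).
Qed.

(** Moving the involution [P] past [U] twice gives [U = l^2 U], so the scalar is a sign. *)
Lemma commute_sign n (U P : 'M[C]_(dimn n)) l :
  U != 0 -> P *m P = 1%:M -> U *m P = l *: (P *m U) ->
  exists b : 'F_2, U *m P = F2_sign C b *: (P *m U).
Proof.
move=> U0 PP E; suff /eqP : l ^+ 2 = 1.
  rewrite sqrf_eq1 => /orP[] /eqP El; first by exists 0; rewrite E El /F2_sign expr0.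
  by exists 1; rewrite E El /F2_sign expr1.
have : U *m P *m P = l ^+ 2 *: U.
  by rewrite E -scalemxAl -mulmxA E -scalemxAr mulmxA PP mul1mx scalerA expr2.
rewrite -mulmxA PP mulmx1 => /eqP; rewrite -{1}[U]scale1r -subr_eq0 -scalerBl.
by rewrite scaler_eq0 (negbTE U0) orbF subr_eq0 eq_sym => /eqP.
Qed.

(** The reversed order of the factors makes this the exact inverse of [pauli1 a b], without a
    sign. *)
Definition pauli1_inv (b a : 'F_2) : 'M[C]_2 :=
  (if b == 0 then 1%:M else mxZ C) *m (if a == 0 then 1%:M else mxX C).

Lemma pauli1_invK a b : pauli1_inv b a *m pauli1 C a b = 1%:M.
Proof.
rewrite /pauli1_inv /pauli1; case: ifP => _; case: ifP => _; 
  rewrite ?mul1mx ?mulmx1 ?mxXX ?mxZZ //.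
by rewrite -mulmxA (mulmxA (mxX C)) mxXX mul1mx mxZZ.
Qed.

Lemma pauli1_Z a b : pauli1 C a b *m mxZ C = F2_sign C a *: (mxZ C *m pauli1 C a b).
Proof.
rewrite /pauli1 /F2_sign; case: (F2_cases a) => ->; case: (F2_cases b) => ->; 
  rewrite ?eqxx ?oner_eq0 ?expr0 ?expr1 ?scale1r ?mul1mx ?mulmx1 //.
- by rewrite mxZX scalerA mulrNN mulr1 scale1r.
- by rewrite mulmxA mxZX -scalemxAl scalerA mulrNN mulr1 scale1r.
Qed.

(** [U] commutes with each X and Z up to a sign. Reading [z] from the X signs and [x] from the Z
    signs gives a Pauli operator [Q] with the same signs; they cancel in [Q U], which is scalar by
    [schur]. *)
Lemma acts1_pauli n (U V : 'M[C]_(dimn n)) : V *m U = 1%:M -> acts U 1%:M ->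
  exists (x z : 'I_n -> 'F_2) (mu : C), U = mu *: tens (fun k => pauli1_inv (z k) (x k)).
Proof.
move=> VU HU.
have U0 : U != 0.
  by apply: contraNneq (mx1_neq0 n) => U0; rewrite -VU U0 mulmx0.
have [z Hz] : exists z : 'I_n -> 'F_2, forall j,
    U *m on1 (mxX C) j = F2_sign C (z j) *: (on1 (mxX C) j *m U).
  apply: (@fin_all_exists _ _ (fun j b => U *m on1 (mxX C) j = F2_sign C b *: (on1 (mxX C) j *m U))) => j.
  have [l] := HU (row_mx (delta_mx 0 j) 0); rewrite mulmx1 pauli_X.
  by apply: commute_sign => //; rewrite on1_mul mxXX on1_1.
have [x Hx] : exists x : 'I_n -> 'F_2, forall j,
    U *m on1 (mxZ C) j = F2_sign C (x j) *: (on1 (mxZ C) j *m U).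
  apply: (@fin_all_exists _ _ (fun j b => U *m on1 (mxZ C) j = F2_sign C b *: (on1 (mxZ C) j *m U))) => j.
  have [l] := HU (row_mx 0 (delta_mx 0 j)); rewrite mulmx1 pauli_Z.
  by apply: commute_sign => //; rewrite on1_mul mxZZ on1_1.
pose Q := tens (fun k => pauli1 C (x k) (z k)).
have QX j : Q *m on1 (mxX C) j = F2_sign C (z j) *: (on1 (mxX C) j *m Q).
  rewrite on1E !tens_mul; apply: (tens_scale (j := j)) => k.
  case: eqP => [->|_]; last by rewrite mul1mx mulmx1.
  by rewrite X_pauli1 scalerA F2_signK scale1r.
have QZ j : Q *m on1 (mxZ C) j = F2_sign C (x j) *: (on1 (mxZ C) j *m Q).
  rewrite on1E !tens_mul; apply: (tens_scale (j := j)) => k.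
  case: eqP => [->|_]; last by rewrite mul1mx mulmx1.
  exact: pauli1_Z.
have [||mu Emu] := @schur n (Q *m U).
- move=> j; rewrite -mulmxA Hz -scalemxAr (mulmxA Q) QX -scalemxAl scalerA F2_signK scale1r.
  by rewrite -(mulmxA _ Q).
- move=> j; rewrite -mulmxA Hx -scalemxAr (mulmxA Q) QZ -scalemxAl scalerA F2_signK scale1r.
  by rewrite -(mulmxA _ Q).
exists x, z, mu.
have QK : tens (fun k => pauli1_inv (z k) (x k)) *m Q = 1%:M.
  by rewrite tens_mul -(tens1 C n); apply: eq_tens => k; rewrite pauli1_invK.
by rewrite -[LHS]mul1mx -QK -mulmxA Emu mul_mx_scalar.
Qed.

Lemma tens_ind n (P : 'M[C]_(dimn n) -> Prop) (f : 'I_n -> 'M_2) :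
  P 1%:M -> (forall A B, P A -> P B -> P (A *m B)) ->
  (forall j, P (on1 (f j) j)) -> P (tens f).
Proof.
move=> P1 PM Pf.
suff H s : uniq s -> P (tens (fun k => if k \in s then f k else 1%:M)).
  have := H (enum 'I_n) (enum_uniq _); congr P; apply: eq_tens => k.
  by rewrite mem_enum.
elim: s => [|j s IH] /=; first by rewrite tens1.
case/andP=> js /IH Ps; have := PM _ _ (Pf j) Ps; congr P.
rewrite on1E tens_mul; apply: eq_tens => k; rewrite inE.
by case: eqP => [->|_] /=; rewrite ?(negbTE js) ?mulmx1 ?mul1mx.
Qed.
End Schur.

(** * Controlled circuits of bounded T-depth *)

Lemma T_depth_le_clifford n D (c : circuit n) (K : clifford_circuit n) :
  T_depth_le D c -> T_depth_le D (c ++ map Clifford K).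
Proof.
case: D => [|D] /=; first by case=> K' ->; exists (K' ++ K); rewrite map_cat.
move=> [c' [L [K' [Hc' HL ->]]]]; exists c', L, (K' ++ K); split=> //.
by rewrite map_cat !catA.
Qed.

(** The Clifford layers that meet at the junction merge into one. *)
Lemma T_depth_le_cat n D1 D2 (c1 c2 : circuit n) :
  T_depth_le D1 c1 -> T_depth_le D2 c2 -> T_depth_le (D1 + D2) (c1 ++ c2).
Proof.
move=> H1; elim: D2 c2 => [|D2 IH] c2 /=.
  by case=> K ->; rewrite addn0; exact: T_depth_le_clifford.
move=> [c' [L [K [Hc' HL ->]]]]; rewrite addnS; exists (c1 ++ c'), L, K.
by split=> //; [exact: IH | rewrite !catA].
Qed.

Lemma T_depth_le_mono n D1 D2 (c : circuit n) :
  (D1 <= D2)%N -> T_depth_le D1 c -> T_depth_le D2 c.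
Proof.
move/subnK <-; elim: (D2 - D1)%N => [|k IH] //= H.
by exists c, [::], [::]; split=> //; [exact: IH | rewrite cats0].
Qed.

Lemma T_depth_le_layer n (L : circuit n) : T_layer L -> T_depth_le 1 L.
Proof.
by move=> HL; exists [::], L, [::]; split=> //; [exists [::] | rewrite cats0].
Qed.

Lemma T_count_clifford n (K : clifford_circuit n) : T_count (map Clifford K) = 0%N.
Proof. by elim: K. Qed.

Lemma T_count_cat n (c1 c2 : circuit n) : T_count (c1 ++ c2) = (T_count c1 + T_count c2)%N.
Proof. exact: count_cat. Qed.

(** * Cheap circuits for controlled unitaries *)

Section Implementation.
Variable C : numClosedFieldType.
Notation w := (omega C).

(** One constant bounds the T-depth and the T-count per qubit, so that costs simply add up in
    products. *)
Definition cheap_control k n (U : 'M[C]_(dimn n)) :=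
  exists c : circuit n.+1,
    [/\ circuit_mx C c = controlled U, T_depth_le k c & (T_count c <= k * n)%N].

(** Block diagonal with respect to the control: [controlled U] is [qblock 1 U], and an operator [A]
    on the targets alone is [qblock A A]. *)
Definition qblock n (A B : 'M[C]_(dimn n)) : 'M_(dimn n.+1) := mxP C 0 *t A + mxP C 1 *t B.

Lemma qblock_mul n (A B A' B' : 'M_(dimn n)) : qblock A B *m qblock A' B' = qblock (A *m A') (B *m B').
Proof.
rewrite /qblock mulmxDl !mulmxDr !tensmx_mul !mul_delta_mx !mul_delta_mx_0 //.
by rewrite !tens0mx addr0 add0r.
Qed.

Lemma qblock_same n (A : 'M_(dimn n)) : qblock A A = 1%:M *t A.
Proof. by rewrite /qblock -tensmxDl mxP01. Qed.

Lemma qblock1 n : qblock 1%:M 1%:M = 1%:M :> 'M_(dimn n.+1).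
Proof. by rewrite qblock_same tensmx11. Qed.

Lemma cheap_control_mul j k n (U V : 'M_(dimn n)) :
  cheap_control j U -> cheap_control k V -> cheap_control (j + k) (U *m V).
Proof.
move=> [c [Ec Dc Tc]] [d [Ed Dd Td]]; exists (d ++ c); split.
- rewrite circuit_mx_cat Ec Ed -[controlled U]/(qblock _ _) -[controlled V]/(qblock _ _) qblock_mul.
  by rewrite mulmx1.
- by rewrite addnC; exact: T_depth_le_cat.
by rewrite T_count_cat mulnDl addnC leq_add.
Qed.

Lemma lift_neq n (j k : 'I_n) : j != k -> lift ord0 j != lift ord0 k.
Proof. by rewrite (inj_eq lift_inj). Qed.

Definition shift_gate n (g : clifford_gate n) : clifford_gate n.+1 :=
  match g with
  | GateH j => GateH (lift ord0 j)
  | GateS j => GateS (lift ord0 j)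
  | GateCNOT j k jk => GateCNOT (lift_neq jk)
  end.

Lemma shift_gate_mx n (g : clifford_gate n) :
  clifford_gate_mx C (shift_gate g) = 1%:M *t clifford_gate_mx C g.
Proof.
case: g => [j|j|j k jk]; [exact: on1_lift | exact: on1_lift |].
rewrite -[LHS]/(mxCNOT C (lift ord0 j) (lift ord0 k)) /mxCNOT !on1_lift.
by rewrite tensmx_mul mulmx1 -tensmxDr.
Qed.

Lemma shift_mx n (c : clifford_circuit n) :
  clifford_mx C (map (@shift_gate n) c) = qblock (clifford_mx C c) (clifford_mx C c).
Proof.
rewrite qblock_same; elim: c => [|g c IH]; first by rewrite tensmx11.
rewrite -[LHS]/(clifford_mx C (map (@shift_gate n) c) *m clifford_gate_mx C (shift_gate g)).
by rewrite IH shift_gate_mx tensmx_mul mul1mx.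
Qed.

Lemma cheap_control_conj k n (c : clifford_circuit n) (U : 'M_(dimn n)) : cheap_control k U ->
  cheap_control k (clifford_mx C (clifford_inv c) *m U *m clifford_mx C c).
Proof.
move=> [d [Ed Dd Td]].
exists (map Clifford (map (@shift_gate n) c) ++ d ++
  map Clifford (map (@shift_gate n) (clifford_inv c))); split.
- rewrite !circuit_mx_cat Ed -!/(clifford_mx _ _) !shift_mx -[controlled U]/(qblock _ _).
  by rewrite !qblock_mul mulmx1 clifford_invK.
- rewrite -[k]add0n; apply: T_depth_le_cat; last exact: T_depth_le_clifford.
  by eexists.
by rewrite !T_count_cat !T_count_clifford addn0.
Qed.

Lemma cheap_control_clifford n (c : clifford_circuit n.+1) (U : 'M_(dimn n)) :
  clifford_mx C c = controlled U -> cheap_control 0 U.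
Proof.
by move=> E; exists (map Clifford c); split=> //; [exists c | rewrite T_count_clifford].
Qed.

(** A T gate on the control is a controlled global phase; this is how powers of [w] are paid for. *)
Lemma T_ord0_mx n : on1 (mxT C) (ord0 : 'I_n.+1) = qblock 1%:M (w *: 1%:M).
Proof.
rewrite on1_ord0 /qblock tensmxZr -tensmxZl -tensmxDl; congr (_ *t _).
apply/matrixP=> -[[|[|?]] ?] // -[[|[|?]] ?] //; rewrite !mxE /=;
  by rewrite ?mulr0 ?mulr0n ?mulr1n ?mulr1 ?addr0 ?add0r.
Qed.

Lemma T_ord0_circuit n k : circuit_mx C (nseq k (GateT (ord0 : 'I_n.+1))) = qblock 1%:M ((w ^+ k)%:M).
Proof.
elim: k => [|k IH]; first by rewrite expr0 qblock1.
rewrite -[LHS]/(circuit_mx C (nseq k _) *m on1 (mxT C) ord0) IH T_ord0_mx qblock_mul mulmx1.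
by rewrite scalemx1 -scalar_mxM exprSr.
Qed.

Lemma T_ord0_depth n k : T_depth_le k (nseq k (GateT (ord0 : 'I_n.+1))).
Proof.
elim: k => [|k IH]; first by exists [::].
rewrite -[k.+1]addn1 nseqD; apply: T_depth_le_cat => //; exact: T_depth_le_layer.
Qed.

Lemma T_ord0_count n k : T_count (nseq k (GateT (ord0 : 'I_n.+1))) = k.
Proof. by rewrite /T_count count_nseq mul1n. Qed.

Lemma omega8 : w ^+ 8 = 1.
Proof. by rewrite (exprM _ 4 2) omega4 sqrrN expr1n. Qed.

Lemma omega_conj : w * w^* = 1.
Proof.
rewrite -normCK; suff -> : `|w| = 1 by rewrite expr1n.
by apply/eqP; rewrite -(@pexpr_eq1 _ _ 8) // -normrX omega8 normr1.
Qed.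

Lemma cheap_control_omega n k : (k < 8)%N -> (0 < n)%N -> cheap_control 7 ((w ^+ k)%:M : 'M_(dimn n)).
Proof.
move=> k8 n0; exists (nseq k (GateT ord0)); split; first exact: T_ord0_circuit.
  by apply: T_depth_le_mono (T_ord0_depth _ _).
by rewrite T_ord0_count; lia.
Qed.

Definition on_seq n (A : 'M[C]_2) (js : seq 'I_n) : 'M[C]_(dimn n) :=
  foldr (fun j M => M *m on1 A j) 1%:M js.

Lemma on_seqE n A (js : seq 'I_n) : uniq js ->
  on_seq A js = tens (fun k => if k \in js then A else 1%:M).
Proof.
elim: js => [|j js IH] /=; first by rewrite tens1.
case/andP=> jjs /IH ->; rewrite on1E tens_mul; apply: eq_tens => k; rewrite inE.
by case: eqP => [->|_] /=; rewrite ?(negbTE jjs) ?mulmx1 ?mul1mx.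
Qed.

Lemma on_seq_mul n A B (js : seq 'I_n) : uniq js ->
  on_seq A js *m on_seq B js = on_seq (A *m B) js.
Proof.
move=> ujs; rewrite !on_seqE // tens_mul; apply: eq_tens => k.
by case: ifP; rewrite ?mulmx1.
Qed.

Lemma on_seq1 n (js : seq 'I_n) : on_seq 1%:M js = 1%:M.
Proof. by elim: js => //= j js ->; rewrite on1_1 mulmx1. Qed.

Lemma on_seqZ n c A (js : seq 'I_n) : on_seq (c *: A) js = c ^+ size js *: on_seq A js.
Proof.
elim: js => [|j js IH] /=; first by rewrite expr0 scale1r.
by rewrite IH on1Z -scalemxAl -scalemxAr scalerA exprSr.
Qed.

Lemma layer_mx n (G : 'I_n.+1 -> gate n.+1) A (js : seq 'I_n) :
  (forall j, gate_mx C (G j) = on1 A j) ->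
  circuit_mx C [seq G (lift ord0 j) | j <- js] = qblock (on_seq A js) (on_seq A js).
Proof.
move=> HG; elim: js => [|j js IH] /=; first by rewrite qblock1.
by rewrite IH HG on1_lift -qblock_same qblock_mul.
Qed.

Definition cnot_fan n (js : seq 'I_n) : clifford_circuit n.+1 :=
  [seq GateCNOT (neq_lift ord0 j) | j <- js].

Lemma CNOT_ord0 n (j : 'I_n) : mxCNOT C ord0 (lift ord0 j) = qblock 1%:M (on1 (mxX C) j).
Proof. by rewrite /mxCNOT !on1_ord0 on1_lift tensmx_mul mulmx1 mul1mx. Qed.

Lemma cnot_fan_mx n (js : seq 'I_n) : clifford_mx C (cnot_fan js) = qblock 1%:M (on_seq (mxX C) js).
Proof.
elim: js => [|j js IH] /=; first by rewrite qblock1.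
rewrite -[LHS]/(clifford_mx C (cnot_fan js) *m mxCNOT C ord0 (lift ord0 j)).
by rewrite IH CNOT_ord0 qblock_mul mulmx1.
Qed.

Lemma mxT_mxTdg : mxT C *m mxTdg C = 1%:M.
Proof.
apply/matrixP=> -[[|[|?]] ?] // -[[|[|?]] ?] //;
 rewrite !(mxE, big_ord_recl, big_ord0) /=
   ?(mulr0n, mulr1n, expr0, expr1, mulr1, mul1r, addr0, mulr0, mul0r, add0r) //.
exact: omega_conj.
Qed.

Lemma mxS_TXTX : mxS C = w *: (mxT C *m mxX C *m mxTdg C *m mxX C).
Proof.
apply/matrixP=> -[[|[|?]] ?] // -[[|[|?]] ?] //;
 rewrite !(mxE, big_ord_recl, big_ord0) /=
   ?(mulr0n, mulr1n, expr0, expr1, mulr1, mul1r, addr0, mulr0, mul0r, add0r) //.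
- by rewrite omega_conj.
- by rewrite -expr2 omega_sqr.
Qed.

Lemma T_layer_lift n (G : 'I_n.+1 -> gate n.+1) (js : seq 'I_n) :
  (forall j, T_qubit (G j) = Some j) -> uniq js ->
  T_layer [seq G (lift ord0 j) | j <- js] /\ T_count [seq G (lift ord0 j) | j <- js] = size js.
Proof.
move=> HG ujs; have E : pmap (@T_qubit _) [seq G (lift ord0 j) | j <- js] = map (lift ord0) js.
  by elim: js {ujs} => //= j js ->; rewrite HG.
have Ha : all (@is_T _) [seq G (lift ord0 j) | j <- js].
  by elim: (js) => //= j js' ->; rewrite /is_T HG.
split; first by rewrite /T_layer Ha E map_inj_uniq //; exact: lift_inj.
by move: Ha; rewrite all_count size_map => /eqP.
Qed.

(** With the control at 0 the two target layers cancel. With the control at 1 the CNOT fans insert X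
    around the [T^dagger] layer and leave S on each target, up to one factor [w] per target, which T
    gates on the control supply. The constant 9 is two target layers plus at most seven T gates on
    the control. *)
Lemma cheap_control_S n (js : seq 'I_n) : (0 < n)%N -> uniq js ->
  cheap_control 9 (clifford_mx C [seq GateS j | j <- js]).
Proof.
move=> n0 ujs.
have ES : clifford_mx C [seq GateS j | j <- js] = on_seq (mxS C) js.
  by elim: js {ujs} => //= j js IH; rewrite -IH.
have [LT cT] := T_layer_lift (G := @GateT n.+1) (fun=> erefl) ujs.
have [LD cD] := T_layer_lift (G := @GateTdg n.+1) (fun=> erefl) ujs.
set LTs := map _ js in LT cT; set LDs := map _ js in LD cD.
(* Since [w ^+ 8 = 1], reducing the exponent modulo 8 keeps the depth independent of the number of
   targets. *)
pose m := (size js %% 8)%N.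
exists (map Clifford (cnot_fan js) ++ LDs ++ map Clifford (cnot_fan js) ++ LTs ++ nseq m (GateT ord0)).
split.
- rewrite !circuit_mx_cat -!/(clifford_mx _ _) cnot_fan_mx T_ord0_circuit.
  rewrite (layer_mx (A := mxT C)) // (layer_mx (A := mxTdg C)) // !qblock_mul.
  rewrite !(mulmx1, mul1mx) !on_seq_mul // mxT_mxTdg on_seq1.
  rewrite mul_scalar_mx -!scalemxAl !on_seq_mul // /m expr_mod ?omega8 //.
  by rewrite -on_seqZ -mxS_TXTX ES.
- apply: (@T_depth_le_mono _ (0 + (1 + (0 + (1 + m))))).
    by have : (m < 8)%N by rewrite ltn_mod; lia.
  apply: T_depth_le_cat; first by exists (cnot_fan js).
  apply: T_depth_le_cat; first exact: T_depth_le_layer.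
  apply: T_depth_le_cat; first by exists (cnot_fan js).
  apply: T_depth_le_cat; first exact: T_depth_le_layer.
  exact: T_ord0_depth.
rewrite !T_count_cat !T_count_clifford cT cD T_ord0_count.
have : (m < 8)%N by rewrite ltn_mod.
have : (size js <= n)%N by rewrite -[X in (_ <= X)%N](card_ord n) -(card_uniqP ujs) max_card.
lia.
Qed.
End Implementation.

(** * Factorisation of Clifford circuits *)

Lemma symplectic_gate n (g : clifford_gate n) : symplectic (gate_symp g).
Proof.
case: g => [j|j|j k jk].
- rewrite /symplectic /gate_symp /wmx tr_block_mx !linearD /= trmx1 trmx_delta.
  rewrite !block_simp; set d := delta_mx j j.
  have dd : d *m d = d by rewrite mul_delta_mx.
  rewrite !mulmxDr !mulmxDl !mulmx1 !mul1mx dd !mxF2_addxx.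
  by rewrite !addr0 addrCA -addrA !mxF2_addxx addr0.
- by apply: symplectic_umx; rewrite trmx_delta.
rewrite /symplectic /gate_symp /wmx tr_block_mx !linearD /= !trmx0 trmx1 !trmx_delta.
rewrite !block_simp !mulmxDr !mulmxDl !mulmx1 !mul1mx !mul_delta_mx_0 // 1?eq_sym //.
by rewrite !addr0 -!addrA !mxF2_addxx !addr0.
Qed.

Lemma symplectic_symp n (c : clifford_circuit n) : symplectic (symp c).
Proof.
elim: c => [|g c IH]; first exact: symplectic1.
by apply: symplectic_mul; first exact: symplectic_gate.
Qed.

Lemma cnot_product_unit n (L : 'M_n) : cnot_product L -> L \in unitmx.
Proof.
elim=> [|j k A jk _ uA]; first exact: unitmx1.
rewrite unitmx_mul uA andbT.
have E : (1%:M + delta_mx j k) *m (1%:M + delta_mx j k) = 1%:M :> 'M['F_2]_n.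
  rewrite !mulmxDr !mulmxDl !mulmx1 !mul1mx mul_delta_mx_0; last by rewrite eq_sym.
  by rewrite addr0 -addrA mxF2_addxx addr0.
by case: (mulmx1_unit E).
Qed.

Lemma dmx_cnot n (j k : 'I_n) (jk : j != k) :
  gate_symp (GateCNOT jk) = dmx (1%:M + delta_mx j k).
Proof.
have E : (1%:M + delta_mx j k) *m (1%:M + delta_mx j k) = 1%:M :> 'M['F_2]_n.
  rewrite !mulmxDr !mulmxDl !mulmx1 !mul1mx mul_delta_mx_0; last by rewrite eq_sym.
  by rewrite addr0 -addrA mxF2_addxx addr0.
have [uE _] := mulmx1_unit E.
rewrite /dmx /=; congr block_mx.
have -> : invmx (1%:M + delta_mx j k) = 1%:M + delta_mx j k :> 'M['F_2]_n.
  by have := mulKmx uE (1%:M + delta_mx j k); rewrite E mulmx1.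
by rewrite linearD /= trmx1 trmx_delta.
Qed.

Lemma cnot_product_symp n (L : 'M_n) : cnot_product L -> exists c, symp c = dmx L.
Proof.
elim=> [|j k A jk eA [c Ec]]; first by exists [::]; rewrite dmx1.
exists (GateCNOT jk :: c); rewrite /= Ec [block_mx _ _ _ _](dmx_cnot jk) dmx_mul //.
  exact/cnot_product_unit/cnot_product_delta.
exact: cnot_product_unit.
Qed.

Lemma symp_S n (js : seq 'I_n) :
  symp [seq GateS j | j <- js] = umx (\sum_(j <- js) delta_mx j j).
Proof.
elim: js => [|j js IH]; first by rewrite big_nil umx0.
by rewrite big_cons umx_add -IH.
Qed.

Lemma symp_H n (js : seq 'I_n) : uniq js ->
  let D := \sum_(j <- js) delta_mx j j in
  symp [seq GateH j | j <- js] = block_mx (1%:M + D) D D (1%:M + D).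
Proof.
elim: js => [|j js IH] /=; first by rewrite big_nil addr0 -scalar_mx_block.
case/andP=> jjs /IH; set D := \sum_(j <- js) _ => ->.
have dD : delta_mx j j *m D = 0.
  rewrite /D mulmx_sumr big_seq big1 // => k kjs; rewrite mul_delta_mx_0 //.
  by apply: contraNneq jjs => ->.
rewrite big_cons mulmx_block !mulmxDr !mulmxDl !mulmx1 !mul1mx dD !addr0.
by rewrite add0r (addrC D) -!addrA.
Qed.

Lemma sum_delta_diag n (D : 'rV['F_2]_n) :
  \sum_(j <- enum 'I_n | D 0 j != 0) delta_mx j j = diag_mx D.
Proof.
rewrite diag_mx_sum_delta -big_enum /= [RHS](bigID (fun j => D 0 j != 0)) /=.
rewrite [X in _ = _ + X]big1 ?addr0; last by move=> j; rewrite negbK => /eqP ->; rewrite scale0r.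
by apply: eq_bigr => j /F2_neq0 ->; rewrite scale1r.
Qed.

Lemma symp_wmx n : exists c : clifford_circuit n, symp c = wmx n.
Proof.
exists [seq GateH j | j <- enum 'I_n]; rewrite symp_H ?enum_uniq //=.
have -> : \sum_(j <- enum 'I_n) delta_mx j j = 1%:M :> 'M['F_2]_n.
  rewrite big_enum /= -diag_const_mx diag_mx_sum_delta.
  by apply: eq_bigr => j _; rewrite mxE scale1r.
by rewrite mxF2_addxx.
Qed.

(** * Cost of symplectic matrices and of the Pauli correction *)

Section Good.
Variables (C : numClosedFieldType) (n : nat).
Hypothesis n0 : (0 < n)%N.

(** This pins the circuit down only modulo Pauli operators and phases, which are corrected once at
    the end, in [cheap_control_circuit]. *)
Definition cheap_symp k (M : 'M['F_2]_(n + n)) :=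
  exists c : clifford_circuit n, symp c = M /\ cheap_control k (clifford_mx C c).

Lemma cheap_mul j k M N : cheap_symp j M -> cheap_symp k N -> cheap_symp (j + k) (M *m N).
Proof.
move=> [c [<- Ic]] [d [<- Id]]; exists (c ++ d); rewrite symp_cat clifford_mx_cat; split=> //.
by rewrite addnC; exact: cheap_control_mul.
Qed.

Lemma cheap_conj k (c : clifford_circuit n) N : cheap_symp k N ->
  cheap_symp k (symp c *m N *m symp (clifford_inv c)).
Proof.
move=> [d [<- Id]]; exists (c ++ d ++ clifford_inv c).
rewrite !symp_cat !clifford_mx_cat !mulmxA; split=> //.
exact: cheap_control_conj.
Qed.

Lemma symp_invE (c : clifford_circuit n) M N : symp c = M -> N *m M = 1%:M ->
  symp (clifford_inv c) = N.
Proof.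
by move=> <- NM; rewrite -[LHS]mul1mx -NM -mulmxA symp_inv mulmx1.
Qed.

Lemma cheap_diag D : cheap_symp 9 (umx (diag_mx D)).
Proof.
exists [seq GateS j | j <- enum 'I_n & D 0 j != 0]; split.
  by rewrite symp_S big_filter sum_delta_diag.
by apply: cheap_control_S => //; rewrite filter_uniq ?enum_uniq.
Qed.

(** [umx (L L^T)] is the conjugate, by the CNOT circuit of [L], of S on every qubit, and
    [umx (diag_mx D)] is a single S layer: 9 + 9. *)
Lemma cheap_umx E : E^T = E -> cheap_symp 18 (umx E).
Proof.
case/sym_factor => L [D [eL ->]]; rewrite umx_add.
have [c Ec] := cnot_product_symp eL; have uL := cnot_product_unit eL.
apply: (@cheap_mul 9 9); last exact: cheap_diag.
have -> : L *m L^T = L *m 1%:M *m L^T by rewrite mulmx1.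
rewrite -dmx_conj // -Ec.
have <- : symp (clifford_inv c) = dmx (invmx L).
  by apply: (symp_invE Ec); rewrite -dmx_mul ?unitmx_inv // mulVmx // dmx1.
by apply: cheap_conj; rewrite -diag_const_mx; exact: cheap_diag.
Qed.

Lemma cheap_lmx E : E^T = E -> cheap_symp 18 (lmx E).
Proof.
move=> symE; have [c Ec] := symp_wmx n; rewrite lmxE -Ec.
have {2}-> : symp c = symp (clifford_inv c).
  by rewrite (symp_invE Ec (wmxK n)).
exact/cheap_conj/cheap_umx.
Qed.

(** Six unipotent factors at 18 each: three in [dmx_sym], and three more for [wmx]. *)
Lemma cheap_dmx_sym S : sym_unit S -> cheap_symp 108 (dmx S).
Proof.
move=> HS; have [symS uS] := HS; rewrite dmx_sym // wmxE.
have symV : (invmx S)^T = invmx S by rewrite trmx_inv symS.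
apply: (@cheap_mul 54 54).
  apply: (@cheap_mul 36 18); last exact: cheap_umx.
  by apply: (@cheap_mul 18 18); [exact: cheap_umx | exact: cheap_lmx].
apply: (@cheap_mul 36 18); last by apply: cheap_umx; rewrite trmx1.
by apply: (@cheap_mul 18 18); [apply: cheap_umx | apply: cheap_lmx]; rewrite trmx1.
Qed.

Lemma cheap_dmx_mul j k A1 A2 : A1 \in unitmx -> A2 \in unitmx ->
  cheap_symp j (dmx A1) -> cheap_symp k (dmx A2) -> cheap_symp (j + k) (dmx (A1 *m A2)).
Proof. by move=> u1 u2 g1 g2; rewrite dmx_mul //; exact: cheap_mul. Qed.

Lemma cheap_dmx_sym4 S1 S2 S3 S4 : sym_unit S1 -> sym_unit S2 -> sym_unit S3 -> sym_unit S4 ->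
  cheap_symp 432 (dmx (S1 *m S2 *m S3 *m S4)).
Proof.
move=> s1 s2 s3 s4; case: (s1) (s2) (s3) (s4) => [_ u1] [_ u2] [_ u3] [_ u4].
apply: (@cheap_dmx_mul 324 108); rewrite ?unitmx_mul ?u1 ?u2 //; last exact: cheap_dmx_sym.
apply: (@cheap_dmx_mul 216 108); rewrite ?unitmx_mul ?u1 ?u2 //; last exact: cheap_dmx_sym.
by apply: (@cheap_dmx_mul 108 108) => //; exact: cheap_dmx_sym.
Qed.

Lemma unit_lower_sym_pos (L : 'M['F_2]_n) : unit_lower L ->
  exists S1 S2 S3 S4, [/\ sym_unit S1, sym_unit S2, sym_unit S3, sym_unit S4
     & L = S1 *m S2 *m S3 *m S4].
Proof. by case: n n0 L => // m _ L; exact: unit_lower_sym. Qed.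

(** Three unitriangular factors, each a product of four symmetric matrices of cost 108. An upper
    factor is reached by transposition, which merely reverses the order of its symmetric factors. *)
Lemma cheap_dmx A : A \in unitmx -> cheap_symp 1296 (dmx A).
Proof.
case/ulu_factor => V [L [W [HV HL HW ->]]].
have uV : V \in unitmx by rewrite -unitmx_tr unit_lower_unitmx.
have uW : W \in unitmx by rewrite -unitmx_tr unit_lower_unitmx.
have uL := unit_lower_unitmx HL.
have good_upper U : unit_lower U^T -> cheap_symp 432 (dmx U).
  case/unit_lower_sym_pos => S1 [S2 [S3 [S4 [s1 s2 s3 s4 E]]]].
  case: (s1) (s2) (s3) (s4) => [t1 _] [t2 _] [t3 _] [t4 _].
  rewrite -[U]trmxK E !trmx_mul t1 t2 t3 t4 !mulmxA; exact: cheap_dmx_sym4.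
apply: (@cheap_dmx_mul 864 432); rewrite ?unitmx_mul ?uV //; last exact: good_upper.
apply: (@cheap_dmx_mul 432 432) => //; first exact: good_upper.
by have [S1 [S2 [S3 [S4 [s1 s2 s3 s4 ->]]]]] := unit_lower_sym_pos HL; exact: cheap_dmx_sym4.
Qed.

Lemma cheap_symplectic M : symplectic M -> cheap_symp 1350 M.
Proof.
case/symplectic_decomp => E [X [A [Y [symE symX symY uA ->]]]].
apply: (@cheap_mul 1332 18); last exact: cheap_umx.
apply: (@cheap_mul 36 1296); last exact: cheap_dmx.
by apply: (@cheap_mul 18 18); [exact: cheap_umx | exact: cheap_lmx].
Qed.

(** The first half lets the Pauli part of a circuit be cancelled within Clifford circuits; the
    second says that its controlled version is Clifford and so costs no T gates. *)
Definition cpauli (P : 'M[C]_(dimn n)) :=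
  (exists q : clifford_circuit n, clifford_mx C q = P) /\
  (exists q : clifford_circuit n.+1, clifford_mx C q = controlled P).

Lemma cpauli_mul P Q : cpauli P -> cpauli Q -> cpauli (P *m Q).
Proof.
move=> [[p Ep] [p' Ep']] [[q Eq] [q' Eq']]; split.
  by exists (q ++ p); rewrite clifford_mx_cat Ep Eq.
exists (q' ++ p'); rewrite clifford_mx_cat Ep' Eq' -/(qblock _ _) -/(qblock _ _) qblock_mul.
by rewrite mulmx1.
Qed.

Lemma cpauli1 : cpauli 1%:M.
Proof. by split; exists [::] => //; rewrite -[RHS]/(qblock _ _) qblock1. Qed.

Lemma mxHZH : mxH C *m mxZ C *m mxH C = mxX C.
Proof.
have := mxH_pauli1 C 1 0; rewrite /pauli1 /= ?eqxx ?oner_eq0 ?mulmx1 ?mul1mx muln0 expr0 scale1r => E.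
by rewrite -[RHS]mul1mx -mxHH -!mulmxA E.
Qed.

Lemma mxHXH : mxH C *m mxX C *m mxH C = mxZ C.
Proof. by rewrite -mxHZH -!mulmxA mxHH mulmx1 !mulmxA mxHH mul1mx. Qed.

Lemma cpauli_X j : cpauli (on1 (mxX C) j).
Proof.
split; first exists [:: GateH j; GateS j; GateS j; GateH j].
  rewrite /clifford_mx /= mul1mx !on1_mul -mulmxA -[_ *m (mxS C *m _)]mulmxA (mulmxA (mxS C)).
  by rewrite mxSS mulmxA mxHZH.
exists [:: GateCNOT (neq_lift ord0 j)].
by rewrite /clifford_mx [LHS]/= mul1mx CNOT_ord0.
Qed.

Lemma cpauli_Z j : cpauli (on1 (mxZ C) j).
Proof.
split; first by exists [:: GateS j; GateS j]; rewrite /clifford_mx /= mul1mx on1_mul mxSS.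
exists [:: GateH (lift ord0 j); GateCNOT (neq_lift ord0 j); GateH (lift ord0 j)].
rewrite -[LHS]/(1%:M *m on1 (mxH C) (lift ord0 j) *m
  mxCNOT C ord0 (lift ord0 j) *m on1 (mxH C) (lift ord0 j)).
rewrite mul1mx on1_lift -qblock_same CNOT_ord0 !qblock_mul mulmx1 !on1_mul mxHH on1_1 mxHXH.
by [].
Qed.

Lemma cpauli_tens (x z : 'I_n -> 'F_2) : cpauli (tens (fun k => pauli1_inv C (z k) (x k))).
Proof.
apply: tens_ind => [|P Q|j]; [exact: cpauli1 | exact: cpauli_mul |].
rewrite /pauli1_inv -on1_mul; apply: cpauli_mul; case: ifP => _; rewrite ?on1_1;
  solve [exact: cpauli1 | exact: cpauli_X | exact: cpauli_Z].
Qed.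

(** A cheap circuit [W] with the symplectic matrix of [U] differs from [U] by a scalar times a Pauli
    operator. The cost is 1350 for [W], 0 for the Pauli operator and 7 for the scalar. *)
Lemma cheap_control_circuit (U : clifford_circuit n) : cheap_control 1357 (clifford_mx C U).
Proof.
have [W [EW IW]] := cheap_symplectic (symplectic_symp U).
(* In time order, so [V] implements [U W^-1]. *)
pose V := clifford_inv W ++ U.
have actV : acts (clifford_mx C V) 1%:M.
  have := acts_circuit C V; rewrite symp_cat -EW.
  by rewrite (mulmx1C (symp_inv W)).
have [x [z [mu Emu]]] := acts1_pauli (clifford_invK C V) actV.
have [[q Eq] [q' Eq']] := cpauli_tens x z.
(* Cancelling the Pauli part leaves a Clifford circuit that is exactly scalar, so [clifford_scalar]
   makes [mu] a power of omega. *)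
have EV : clifford_mx C (V ++ clifford_inv q) = mu%:M.
  by rewrite clifford_mx_cat Emu -Eq -scalemxAr clifford_invK scalemx1.
have [k [k8 Ek]] := clifford_scalar EV.
have -> : clifford_mx C U = mu%:M *m (clifford_mx C q *m clifford_mx C W).
  rewrite mul_scalar_mx scalemxAl Eq -Emu clifford_mx_cat -mulmxA.
  by rewrite clifford_invK mulmx1.
rewrite Ek; apply: (@cheap_control_mul C 7 1350); first exact: cheap_control_omega.
by apply: (@cheap_control_mul C 0 1350) => //; apply: (@cheap_control_clifford C n q'); rewrite Eq' Eq.
Qed.
End Good.

Theorem theorem5 :
  exists K : nat,
    forall (C : numClosedFieldType) (n : nat), (3 <= n)%N ->
    forall U : clifford_circuit n,
    exists c : circuit n.+1,
      [/\ circuit_mx C c = controlled (clifford_mx C U),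
          T_depth_le K c
        & (T_count c <= K * n)%N].
Proof.
exists 1357 => C n n3 U; apply: cheap_control_circuit.
exact: leq_trans n3.
Qed.
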